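(* Let $I$ be a finite alphabet, let $(S_i)_{i\in I}$ be contracting similarities of $\mathbb R^d$, and let $A=(A_{ij})_{i,j\in I}$ be an irreducible zero--one matrix. Let $F_A$, $F_A^w$, $G_i$ be the associated sets defined in the context, and suppose $s:=\dim_{\mathrm H}F_A>0$. Then $\dim_{\mathrm P}F_A=s$. Moreover, for $K=F_A^w$ with $w$ any finite nonempty word over $I$, or $K=G_i$ with $i\in I$, and for every $0<\delta<\infty$, $$\mathcal M^s_\infty(K)=\mathcal M^s_\delta(K)=\mathcal M^s(K)<\infty.$$
   Context: Subshift setting. $\Sigma_A=\{\alpha\in I^{\mathbb N}:A_{\alpha_k\alpha_{k+1}}=1\text{ for every }k\ge1\}$. $A$ is irreducible if for all $i,j\in I$ there is $n\ge1$ with $(A^n)_{ij}>0$. Each $S_i$ is a similarity of $\mathbb R^d$ with ratio $a_i\in(0,1)$. The coding map is $\Pi(\alpha)=\lim_{n\to\infty}S_{\alpha_1}\circ\cdots\circ S_{\alpha_n}(x_0)$ for $\alpha\in I^{\mathbb N}$, independent of $x_0\in\mathbb R^d$. For a finite nonempty word $w=w_1\cdots w_n$, $[w]=\{\alpha\in I^{\mathbb N}:\alpha_k=w_k,\ 1\le k\le n\}$. Put $F_A=\Pi(\Sigma_A)$, $F_A^w=\Pi(\Sigma_A\cap[w])$ (possibly empty), and $G_i=\bigcup_{j:A_{ij}=1}F_A^j$. $\dim_{\mathrm H}$ and $\dim_{\mathrm P}$ are Hausdorff and packing dimension. Labelled packing quantities on $\mathbb R^d$ (Euclidean metric). $|E|$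 is the diameter, $|\varnothing|=0$. For nonempty $E\subset\mathbb R^d$ and $0<R<\infty$ with $|E|\le R$, $$\Phi^s(E,R):=\sup\Big\{\sum_{i=1}^N(2r_i)^s: N\ge1,\ x_i\in\overline E,\ 0<r_i\le R,\ |x_i-x_j|\ge r_i+r_j\ (i\ne j)\Big\},$$ and $\Phi^s(\varnothing,R):=0$. For $0<\delta<\infty$, $$\mathcal M^s_\delta(F):=\inf\Big\{\sum_{j=1}^\infty\Phi^s(E_j,R_j):F\subseteq\bigcup_{j}E_j,\ |E_j|\le R_j\le\delta,\ R_j>0\Big\},$$ $\mathcal M^s(F):=\lim_{\delta\downarrow0}\mathcal M^s_\delta(F)=\sup_{0<\delta<1}\mathcal M^s_\delta(F)$, and $$\mathcal M^s_\infty(F):=\inf\Big\{\sum_j\Phi^s(E_j,R_j):F\subseteq\bigcup_jE_j,\ |E_j|\le R_j,\ 0<R_j<\infty\Big\}$$ (countable covers). *)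

(* Defs.v *)
From HB Require Import structures.
From mathcomp Require Import all_boot all_order all_algebra.
From mathcomp Require Import all_classical all_reals all_analysis.

Set Implicit Arguments.
Unset Strict Implicit.
Unset Printing Implicit Defensive.

Import Order.TTheory GRing.Theory Num.Theory.
Import numFieldNormedType.Exports.

Local Open Scope classical_set_scope.
Local Open Scope ring_scope.

(* R^d is 'rV[R]_d. The library's norm on matrices is the sup norm; it induces
   the same topology (used below for [closure] and [lim]), but distances,
   diameters and balls have to be Euclidean. *)
Definition edist (R : realType) (d : nat) (x y : 'rV[R]_d) : R :=
  Num.sqrt (\sum_(k < d) (x 0 k - y 0 k) ^+ 2).

(* The extra point 0 makes the diameter of the empty set 0 instead of -oo. *)
Definition ediam (R : realType) (d : nat) (E : set 'rV[R]_d) : \bar R :=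
  ereal_sup ([set 0%E] `|` [set (edist p.1 p.2)%:E | p in E `*` E]).

Definition ecball (R : realType) (d : nat) (x : 'rV[R]_d) (r : R) :
    set 'rV[R]_d :=
  [set y | edist x y <= r].

Definition is_similarity (R : realType) (d : nat) (c : R)
    (f : 'rV[R]_d -> 'rV[R]_d) : Prop :=
  forall x y, edist (f x) (f y) = c * edist x y.

Section Subshift.
Variables (R : realType) (d : nat) (I : finType).
Variables (S : I -> 'rV[R]_d -> 'rV[R]_d) (A : rel I).

Definition transition_mx : 'M[nat]_#|I| :=
  \matrix_(p, q) (A (enum_val p) (enum_val q) : nat).

Definition irreducible_mx : Prop :=
  forall i j : I, exists2 n : nat, (1 <= n)%N &
    (0 < (transition_mx ^+ n) (enum_rank i) (enum_rank j))%N.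

(* Infinite words are indexed from 0. *)
Definition subshift : set (nat -> I) :=
  [set alpha | forall k, A (alpha k) (alpha k.+1)].

Definition cylinder (w : seq I) : set (nat -> I) :=
  [set alpha | forall k, (k < size w)%N -> alpha k = nth (alpha k) w k].

(* [foldr S x (mkseq alpha n)] is S_(alpha 0) (... (S_(alpha n.-1) x)). The base
   point is 0; the limit does not depend on it when all S i are contractions. *)
Definition coding (alpha : nat -> I) : 'rV[R]_d :=
  lim ((fun n => foldr S (0 : 'rV[R]_d) (mkseq alpha n)) @ \oo).

Definition FA : set 'rV[R]_d := coding @` subshift.

Definition FAw (w : seq I) : set 'rV[R]_d :=
  coding @` (subshift `&` cylinder w).

Definition GA (i : I) : set 'rV[R]_d :=
  \bigcup_(j in [set j | A i j]) FAw [:: j].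

End Subshift.

Section Dimensions.
Variables (R : realType) (d : nat).
Implicit Types (E F : set 'rV[R]_d) (s delta : R).
Local Open Scope ereal_scope.

(* The case distinction matters only for s = 0, where 0 `^ 0 = 1. *)
Definition hausdorff_cost s E : \bar R :=
  if E == set0 then 0 else ediam E `^ s.

Definition hausdorff_content s delta F : \bar R :=
  ereal_inf [set c | exists E : nat -> set 'rV[R]_d,
    [/\ F `<=` \bigcup_j E j,
        forall j, ediam (E j) <= delta%:E &
        c = \sum_(0 <= j <oo) hausdorff_cost s (E j)]].

(* The limit as delta decreases to 0 is a supremum. *)
Definition hausdorff_measure s F : \bar R :=
  ereal_sup [set hausdorff_content s delta F | delta in [set e : R | (0 < e)%R]].

Definition hausdorff_dim F : \bar R :=
  ereal_inf [set s%:E | s in [set t : R | (0 <= t)%R /\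
                                          hausdorff_measure t F = 0]].

(* Finite packings suffice: the sum over a countable packing is the supremum of
   the sums over its finite subfamilies. *)
Definition packing_content s delta F : \bar R :=
  ereal_sup [set c | exists (N : nat) (x : 'I_N -> 'rV[R]_d) (r : 'I_N -> R),
    [/\ forall i, F (x i),
        forall i, (0 < r i <= delta)%R,
        forall i j, i != j -> ecball (x i) (r i) `&` ecball (x j) (r j) = set0 &
        c = (\sum_(i < N) (2 * r i) `^ s)%R%:E]].

(* The limit as delta decreases to 0 is an infimum. *)
Definition packing_premeasure s F : \bar R :=
  ereal_inf [set packing_content s delta F | delta in [set e : R | (0 < e)%R]].

Definition packing_measure s F : \bar R :=
  ereal_inf [set c | exists E : nat -> set 'rV[R]_d,
    F `<=` \bigcup_j E j /\
    c = \sum_(0 <= j <oo) packing_premeasure s (E j)].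

Definition packing_dim F : \bar R :=
  ereal_inf [set s%:E | s in [set t : R | (0 <= t)%R /\
                                          packing_measure t F = 0]].

End Dimensions.

Section LabelledPacking.
Variables (R : realType) (d : nat).
Implicit Types (E F : set 'rV[R]_d) (s delta rho : R).
Local Open Scope ereal_scope.

Definition Phi s E rho : \bar R :=
  if E == set0 then 0 else
  ereal_sup [set c | exists (N : nat) (x : 'I_N -> 'rV[R]_d) (r : 'I_N -> R),
    [/\ (1 <= N)%N,
        forall i, closure E (x i),
        forall i, (0 < r i <= rho)%R,
        forall i j, i != j -> (r i + r j <= edist (x i) (x j))%R &
        c = (\sum_(i < N) (2 * r i) `^ s)%R%:E]].

Definition M_delta s delta F : \bar R :=
  ereal_inf [set c | exists (E : nat -> set 'rV[R]_d) (rho : nat -> R),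
    [/\ F `<=` \bigcup_j E j,
        forall j, ediam (E j) <= (rho j)%:E,
        forall j, (0 < rho j <= delta)%R &
        c = \sum_(0 <= j <oo) Phi s (E j) (rho j)]].

Definition M_measure s F : \bar R :=
  ereal_sup [set M_delta s delta F | delta in [set e : R | (0 < e < 1)%R]].

Definition M_infty s F : \bar R :=
  ereal_inf [set c | exists (E : nat -> set 'rV[R]_d) (rho : nat -> R),
    [/\ F `<=` \bigcup_j E j,
        forall j, ediam (E j) <= (rho j)%:E,
        forall j, (0 < rho j)%R &
        c = \sum_(0 <= j <oo) Phi s (E j) (rho j)]].

End LabelledPacking.

(* Main.v *)
Require Import Defs.
From mathcomp Require Import all_boot all_order all_algebra.
From mathcomp Require Import all_classical all_reals all_analysis.
From mathcomp Require Import ring lra.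

(** In the absence of separation the argument rests on one fact.  If finitely
    many similarities of ratios [q_j < 1] map a compact set [K] into itself with
    images at positive mutual distance, then [sum_j q_j ^ s <= 1] for
    [s = dim_H K]: otherwise [sum_j q_j ^ u >= 1] for some [u > s] with
    [H^u(K) = 0], whereas pulling covers back along the maps shows that every
    finite cover of [K] has [u]-cost bounded below.

    By irreducibility, every ball of radius [r] centred in [K = F_A^i] contains
    a similar copy of [K] of ratio at least [c * r].  Placing such copies in the
    balls of a packing bounds the packing sums of exponent [s] of [K]
    uniformly; hence the packing premeasures of exponent [t > s] vanish and
    [M^s(K)] is finite.

    For [M^s(K) <= M^s_infty(K)], choose a finite separated family of small
    copies of [K] in [K] whose sum of [q_j ^ s] is within [eps] of the supremum.
    Transporting a cover of [K] of cost [theta] to the copies costs at most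
    [theta], as [sum_j q_j ^ s <= 1].  Any packing that avoids the copies extends
    the family, so its sum is [O(eps)]; cutting the rest of [K] into Whitney
    cells, coloured so that cells of equal colour are far apart, covers it at
    cost [O(eps)].  The sets [F_A^w] and [G_i] reduce to the [F_A^i] by scaling. *)

Set Implicit Arguments.
Unset Strict Implicit.
Unset Printing Implicit Defensive.

Import Order.TTheory GRing.Theory Num.Theory.
Import numFieldNormedType.Exports.
(* [edist] is also a constant of the analysis library. *)
Import Defs.

Local Open Scope classical_set_scope.
Local Open Scope ring_scope.

(** * Euclidean distance *)

(** Lagrange's identity: the double sum of [(a k * b l - a l * b k) ^+ 2] is twice the difference of
    the two sides. *)
Lemma Cauchy_Schwarz_sum (R : realFieldType) (J : finType) (a b : J -> R) :
  (\sum_k a k * b k) ^+ 2 <= (\sum_k a k ^+ 2) * (\sum_k b k ^+ 2).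
Proof.
have : 0 <= \sum_k \sum_l (a k * b l - a l * b k) ^+ 2.
  by apply: sumr_ge0 => k _; apply: sumr_ge0 => l _; exact: sqr_ge0.
have -> : \sum_k \sum_l (a k * b l - a l * b k) ^+ 2 =
  (\sum_k a k ^+ 2) * (\sum_k b k ^+ 2) +
  (\sum_k b k ^+ 2) * (\sum_k a k ^+ 2)
  - 2 * ((\sum_k a k * b k) * (\sum_k a k * b k)).
  rewrite !big_distrlr /= mulr_sumr -big_split -sumrB /=; apply: eq_bigr => k _.
  rewrite mulr_sumr -big_split -sumrB /=; apply: eq_bigr => l _.
  by ring.
by rewrite expr2; lra.
Qed.

Section EuclideanDistance.
Variables (R : realType) (d : nat).
Implicit Types (x y z : 'rV[R]_d).

Lemma edist_ge0 x y : 0 <= edist x y.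
Proof. exact: sqrtr_ge0. Qed.

Lemma edist_sq x y : edist x y ^+ 2 = \sum_(k < d) (x 0 k - y 0 k) ^+ 2.
Proof. by rewrite sqr_sqrtr // sumr_ge0 // => k _; exact: sqr_ge0. Qed.

Lemma edistxx x : edist x x = 0.
Proof.
by rewrite /edist big1 ?sqrtr0 // => k _; rewrite subrr expr0n.
Qed.

Lemma edistC x y : edist x y = edist y x.
Proof. by congr Num.sqrt; apply: eq_bigr => k _; rewrite -sqrrN opprB. Qed.

Lemma edist_triangle y x z : edist x z <= edist x y + edist y z.
Proof.
rewrite -(@ler_pXn2r _ 2) ?nnegrE ?addr_ge0 ?edist_ge0 //.
set a := fun k : 'I_d => x 0 k - y 0 k; set b := fun k : 'I_d => y 0 k - z 0 k.
have CS := Cauchy_Schwarz_sum a b.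
rewrite -!edist_sq -exprMn in CS.
have {}CS : \sum_k a k * b k <= edist x y * edist y z.
  by apply: le_trans (ler_norm _) _;
    rewrite -(@ler_pXn2r _ 2) ?nnegrE ?mulr_ge0 ?edist_ge0 // real_normK ?num_real.
rewrite sqrrD !edist_sq.
have -> : \sum_(k < d) (x 0 k - z 0 k) ^+ 2 =
  \sum_k a k ^+ 2 + 2 * (\sum_k a k * b k) + \sum_k b k ^+ 2.
  rewrite mulr_sumr -!big_split /=; apply: eq_bigr => k _.
  by rewrite /a /b; ring.
rewrite lerD2r lerD2l -mulr_natl; lra.
Qed.

Lemma ler_coord_edist x y k : `|x 0 k - y 0 k| <= edist x y.
Proof.
rewrite -(@ler_pXn2r _ 2) ?nnegrE ?edist_ge0 // real_normK ?num_real //.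
rewrite edist_sq (bigD1 k) //= lerDl sumr_ge0 // => l _; exact: sqr_ge0.
Qed.

Lemma edist_le_sup x y (e : R) :
  (forall k, `|x 0 k - y 0 k| <= e) -> edist x y <= d%:R * e.
Proof.
(* The hypothesis gives the sign of [e] only if there is a coordinate; for [d] = 0 both sides
   vanish. *)
move=> h; have e0 : (0 < d)%N -> 0 <= e.
  by move=> d0; apply: le_trans (normr_ge0 _) (h (Ordinal d0)).
have de : 0 <= d%:R * e.
  by case: (posnP d) => [->|/e0 e0']; rewrite ?mul0r ?mulr_ge0.
rewrite -(@ler_pXn2r _ 2) ?nnegrE ?edist_ge0 // edist_sq.
apply: (@le_trans _ _ (\sum_(k < d) e ^+ 2)).
  apply: ler_sum => k _.
  have e0' := e0 (leq_ltn_trans (leq0n _) (ltn_ord k)).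
  by rewrite -(@real_normK _ (x 0 k - y 0 k)) ?num_real // ler_pXn2r ?nnegrE.
rewrite sumr_const card_ord -[leLHS]mulr_natl exprMn ler_wpM2r ?sqr_ge0 //.
by rewrite -natrX ler_nat expnS expn1; case: (d) => // n; rewrite leq_pmulr.
Qed.

Lemma edist_le0 x y : (forall e : R, 0 < e -> edist x y <= e) -> x = y.
Proof.
move=> h; apply/rowP => k; apply/eqP; rewrite -subr_eq0 -normr_le0.
apply: le_trans (ler_coord_edist x y k) _.
by apply/ler_addgt0Pr => e e0; rewrite add0r h.
Qed.

(** Closure refers to the sup norm. A sup ball of radius [e / d.+1] lies inside the Euclidean ball
    of radius [e], also when [d] = 0. *)
Lemma closure_edist (E : set 'rV[R]_d) x (e : R) :
  closure E x -> 0 < e -> exists2 y, E y & edist x y < e.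
Proof.
move=> Ex e0; have e1 : 0 < e / (d.+1)%:R by rewrite divr_gt0.
have [y [Ey [_ bxy]]] := Ex _ (nbhsx_ballx x _ e1).
exists y => //.
apply: (@le_lt_trans _ _ (d%:R * (e / d.+1%:R))).
  by apply: edist_le_sup => k; have := bxy 0 k; rewrite /ball /= => /ltW.
by rewrite mulrCA gtr_pMr // ltr_pdivrMr ?mul1r ?ltr_nat // ltr0n.
Qed.

Lemma edist_segment x y (t : R) : 0 <= t ->
  edist x (x + t *: (y - x)) = t * edist x y.
Proof.
move=> t0; rewrite /edist -[t in RHS]ger0_norm // -sqrtr_sqr -sqrtrM ?sqr_ge0 //.
by congr Num.sqrt; rewrite mulr_sumr; apply: eq_bigr => k _; rewrite !mxE; ring.
Qed.

(** If the centres were closer, the point dividing the segment between them in the ratio r : r'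
    would lie in both balls. This translates disjointness of balls into the distance condition of
    [is_packing]. *)
Lemma disjoint_ecball x y (r r' : R) : 0 < r -> 0 < r' ->
  ecball x r `&` ecball y r' = set0 -> r + r' <= edist x y.
Proof.
move=> r0 r'0 dis; rewrite leNgt; apply/negP => lt_d.
have rr0 : 0 < r + r' by rewrite addr_gt0.
set t := r / (r + r').
have t0 : 0 <= t by rewrite divr_ge0 ?ltW.
have tE : (1 - t) * (r + r') = r'.
  by rewrite /t; field; rewrite gt_eqF.
have t1 : 0 <= 1 - t.
  by rewrite -(pmulr_lge0 _ rr0) tE ltW.
have : (ecball x r `&` ecball y r') (x + t *: (y - x)).
  split; rewrite /ecball /=.
    rewrite edist_segment //; apply: (@le_trans _ _ (t * (r + r'))).
      by rewrite ler_wpM2l // ltW.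
    by rewrite /t divfK // gt_eqF.
  have -> : x + t *: (y - x) = y + (1 - t) *: (x - y).
    by apply/rowP => k; rewrite !mxE; ring.
  rewrite edist_segment // edistC -[leRHS]tE ler_wpM2l // ltW //.
by rewrite dis.
Qed.

Lemma cvg_edist_lim (u : nat -> 'rV[R]_d) (b : nat -> R) :
  b @ \oo --> (0 : R) ->
  (forall m n, (m <= n)%N -> edist (u m) (u n) <= b m) ->
  forall m, edist (u m) (lim (u @ \oo)) <= b m.
Proof.
move=> b0 ub.
(* [lim] is informative only once convergence is known; the bound makes [u] a Cauchy sequence. *)
have /cvg_ballP ul : cvg (u @ \oo).
  apply/cauchy_cvgP/cauchy_exP => e e0.
  move/cvgrPdist_lt : b0 => /(_ _ e0)[N _ hN].
  exists (u N), N => // n /= Nn; split=> // i k.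
  rewrite (ord1 i) /ball /=.
  apply: le_lt_trans (ler_coord_edist _ _ _) _.
  apply: le_lt_trans (ub _ _ Nn) _.
  by have := hN N (leqnn _); rewrite sub0r normrN; apply: le_lt_trans (ler_norm _).
move=> m; apply/ler_addgt0Pr => e e0.
have e1 : 0 < e / d.+1%:R by rewrite divr_gt0.
have [N _ hN] := ul _ e1.
set n := maxn m N.
apply: le_trans (edist_triangle (u n) _ _) _.
apply: lerD; first by rewrite ub // leq_maxl.
rewrite edistC.
apply: (@le_trans _ _ (d%:R * (e / d.+1%:R))).
  apply: edist_le_sup => k; have [_ /(_ 0 k)] := hN n (leq_maxr _ _).
  by rewrite /ball /= => /ltW.
by rewrite mulrCA ger_pMr // ler_pdivrMr ?mul1r ?ler_nat // ltr0n.
Qed.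

End EuclideanDistance.

(** * Packing sums of labelled sets *)

Lemma le_powR2l (R : realType) (s x y : R) : 0 <= s -> 0 <= x -> x <= y ->
  x `^ s <= y `^ s.
Proof.
move=> s0 x0 xy; apply: ge0_ler_powR => //; rewrite nnegrE //.
exact: le_trans xy.
Qed.

Lemma powRVl (R : realType) (x s : R) : 0 <= x -> x^-1 `^ s = (x `^ s)^-1.
Proof. by move=> x0; rewrite -powR_inv1 // -powRrM mulN1r powRN. Qed.

Section CountableSums.
Variable R : realType.
Implicit Types (B : \bar R).
Local Open Scope ereal_scope.

Lemma nneseries_le (u : nat -> \bar R) B : (forall n, 0 <= u n) ->
  (forall n, \sum_(0 <= i < n) u i <= B) -> \sum_(0 <= i <oo) u i <= B.
Proof.
move=> u0 uB; apply: lime_le; first by apply: is_cvg_nneseries => n _ _.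
by apply: nearW => n; exact: uB.
Qed.

(** A countable family is summed along its encoding, codes of no element contributing 0. Every
    partial sum is then a sum over a duplicate-free list. *)
Lemma nneseries_pickle_le (T : countType) (c : T -> \bar R) B :
  (forall t, 0 <= c t) ->
  (forall l : seq T, uniq l -> \sum_(t <- l) c t <= B) ->
  \sum_(0 <= n <oo) oapp c 0 (pickle_inv n) <= B.
Proof.
move=> c0 cB; apply: nneseries_le => n; first by case: pickle_inv => //=.
rewrite -big_pmap; apply: cB.
by apply: pmap_uniq (iota_uniq _ _); exact: pickle_invK.
Qed.

Lemma nneseries_sum_ge (u : nat -> \bar R) (l : seq nat) : uniq l ->
  (forall n, 0 <= u n) -> \sum_(n <- l) u n <= \sum_(0 <= i <oo) u i.
Proof.
move=> ul u0; apply: le_trans (nneseries_lim_ge (\max_(n <- l) n).+1 _) => //.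
rewrite [leRHS]big_mkord -[leRHS](big_mkord xpredT).
rewrite [leRHS](bigID (mem l)) /=.
rewrite -[leLHS]adde0; apply: leeD; last by apply: sume_ge0 => i _.
rewrite -[leRHS]big_filter; rewrite le_eqVlt; apply/orP; left; apply/eqP/perm_big/uniq_perm => //.
  by rewrite filter_uniq // iota_uniq.
move=> n; rewrite mem_filter mem_index_iota /=.
case nl : (n \in l) => //=; apply/esym.
by rewrite ltnS; exact: leq_bigmax_seq.
Qed.

End CountableSums.

Section Diameter.
Variables (R : realType) (d : nat).
Implicit Types (E F : set 'rV[R]_d).

Lemma ediam_le E (b : R) : 0 <= b ->
  (forall x y, E x -> E y -> edist x y <= b) -> (ediam E <= b%:E)%E.
Proof.
move=> b0 h; apply/ereal_supP => _ [->|[[x y] [/= Ex Ey] <-]].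
  by rewrite lee_fin.
by rewrite lee_fin h.
Qed.

Lemma ediam_ge E x y : E x -> E y -> ((edist x y)%:E <= ediam E)%E.
Proof.
by move=> Ex Ey; apply: ereal_sup_ubound; right; exists (x, y).
Qed.

Lemma ediam_ge0 E : (0 <= ediam E)%E.
Proof. by apply: ereal_sup_ubound; left. Qed.

Lemma edist_le_ediam E x y (b : R) : (ediam E <= b%:E)%E -> E x -> E y ->
  edist x y <= b.
Proof.
by move=> Eb Ex Ey; rewrite -lee_fin; apply: le_trans Eb; exact: ediam_ge.
Qed.

Lemma ediam_le_expanding E F h (k b : R) : 0 < k -> 0 <= b ->
  (forall x, E x -> F (h x)) ->
  (forall x y, E x -> E y -> edist (h x) (h y) = k * edist x y) ->
  (ediam F <= (k * b)%:E)%E -> (ediam E <= b%:E)%E.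
Proof.
move=> k0 b0 EF hk Fb; apply: ediam_le => // x y Ex Ey.
by rewrite -(ler_pM2l k0) -hk //; apply: (edist_le_ediam Fb); apply: EF.
Qed.

Lemma ediam_set0 : ediam (set0 : set 'rV[R]_d) = 0%E.
Proof.
by apply/eqP; rewrite eq_le ediam_ge0 andbT; apply: ediam_le.
Qed.

End Diameter.

(** An arbitrary index type allows two packings to be glued along a sum type. *)
Definition is_packing (R : realType) (d : nat) (J : Type) (x : J -> 'rV[R]_d)
    (r : J -> R) : Prop :=
  forall i j, i <> j -> r i + r j <= edist (x i) (x j).

Section PhiTheory.
Variables (R : realType) (d : nat) (s : R).
Hypothesis s_gt0 : 0 < s.
Implicit Types (E F : set 'rV[R]_d) (rho : R).

Lemma Phi_set0 rho : Phi s (set0 : set 'rV[R]_d) rho = 0%E.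
Proof. by rewrite /Phi eqxx. Qed.

Lemma Phi_ge_radius E rho y : 0 < rho -> E y ->
  (((2 * rho) `^ s)%:E <= Phi s E rho)%E.
Proof.
move=> rho0 Ey; have E0 : E != set0 by apply/set0P; exists y.
rewrite /Phi (negbTE E0); apply: ereal_sup_ubound.
exists 1%N, (fun=> y), (fun=> rho); split=> //.
- by move=> _; exact: subset_closure.
- by move=> _; rewrite rho0 lexx.
- by move=> i j; rewrite (ord1 i) (ord1 j) eqxx.
- by rewrite big_ord1.
Qed.

Lemma Phi_ge0 E rho : 0 < rho -> (0 <= Phi s E rho)%E.
Proof.
move=> rho0; have [->|/set0P[y Ey]] := eqVneq E set0; first by rewrite Phi_set0.
by apply: le_trans (Phi_ge_radius rho0 Ey); rewrite lee_fin powR_ge0.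
Qed.

Lemma Phi_ge (J : finType) E rho (x : J -> 'rV[R]_d) (r : J -> R) : 0 < rho ->
  (forall i, E (x i)) -> (forall i, 0 < r i <= rho) -> is_packing x r ->
  ((\sum_i (2 * r i) `^ s)%:E <= Phi s E rho)%E.
Proof.
move=> rho0 Ex rrho xr.
have [J0|J0] := posnP #|J|.
  rewrite big1 ?Phi_ge0 // => i _.
  by move/eqP : J0; rewrite -leqn0 leqNgt => /negP[]; apply/card_gt0P; exists i.
have E0 : E != set0.
  by case/card_gt0P : J0 => i _; apply/set0P; exists (x i).
rewrite /Phi (negbTE E0); apply: ereal_sup_ubound.
exists #|J|, (x \o enum_val), (r \o enum_val); split=> //.
- by move=> i; apply: subset_closure; exact: Ex.
- by move=> i; exact: rrho.
- by move=> i j ij; apply: xr => /enum_val_inj /eqP; exact/negP.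
- by rewrite (big_enum_val (A := J)).
Qed.

(* Centres in the closure of [E] can be moved into [E] at the cost of shrinking
   all radii by a factor arbitrarily close to 1. *)
Lemma Phi_le E rho (b : R) : 0 <= b ->
  (forall (J : finType) (x : J -> 'rV[R]_d) (r : J -> R),
    (forall i, E (x i)) -> (forall i, 0 < r i <= rho) -> is_packing x r ->
    \sum_i (2 * r i) `^ s <= b) ->
  (Phi s E rho <= b%:E)%E.
Proof.
move=> b0 h; rewrite /Phi; case: eqP => [_|E0]; first by rewrite lee_fin.
apply/ereal_supP => _ [N [x [r [N1 Ex rrho xr ->]]]]; rewrite lee_fin.
set T := \sum_(i < N) _; rewrite leNgt; apply/negP => bT.
have T0 : 0 < T by exact: le_lt_trans bT.
(* The factor [t] is chosen so that shrinking all radii by it turns the sum [T] into [b'], which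
   still exceeds [b]. *)
set b' := (b + T) / 2.
have b'b : b < b' by rewrite /b'; lra.
have b'T : b' < T by rewrite /b'; lra.
have b'0 : 0 < b' by exact: le_lt_trans b'b.
set t := (b' / T) `^ s^-1.
have t0 : 0 < t by rewrite powR_gt0 // divr_gt0.
have ts : t `^ s = b' / T.
  by rewrite -powRrM mulVf ?gt_eqF // powRr1 // divr_ge0 ?ltW.
have t1 : t < 1.
  have u0 : 0 <= b' / T by rewrite divr_ge0 // ltW.
  have u1 : b' / T < 1 by rewrite ltr_pdivrMr // mul1r.
  have := @gt0_ltr_powR _ s^-1 _ (b' / T) 1 _ _ u1; rewrite powR1; apply.
  - by rewrite invr_gt0.
  - by rewrite nnegrE.
  - by rewrite nnegrE.
(* Moving two centres by less than (1 - t) e each shortens their distance by less than what the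
   shrinking of the two radii frees. *)
pose e := \big[Order.min/1]_(i < N) r i.
have e0 : 0 < e.
  by apply/bigmin_gtP; split=> // i _; have /andP[] := rrho i.
have er i : e <= r i by exact: bigmin_le.
have ex i : exists y, E y /\ edist (x i) y < (1 - t) * e.
  have te : 0 < (1 - t) * e by rewrite mulr_gt0 // subr_gt0.
  by have [y Ey xy] := closure_edist (Ex i) te; exists y.
have [y yP] := choice ex.
have : \sum_(i < N) (2 * (t * r i)) `^ s <= b.
  apply: (h _ y).
  - by move=> i; have [] := yP i.
  - move=> i; have /andP[ri0 rir] := rrho i; rewrite mulr_gt0 //=.
    by apply: le_trans rir; rewrite ger_pMl // ltW.
  - move=> i j /eqP ij; have rij := xr _ _ ij.
    have [_ yi] := yP i; have [_ yj] := yP j.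
    have := edist_triangle (y i) (x i) (x j).
    have := edist_triangle (y j) (y i) (x j).
    rewrite (edistC (y j) (x j)) => h1 h2.
    have ei : (1 - t) * e <= (1 - t) * r i by rewrite ler_wpM2l // subr_ge0 ltW.
    have ej : (1 - t) * e <= (1 - t) * r j by rewrite ler_wpM2l // subr_ge0 ltW.
    lra.
have -> : \sum_(i < N) (2 * (t * r i)) `^ s = t `^ s * T.
  rewrite mulr_sumr; apply: eq_bigr => i _.
  have /andP[ri0 _] := rrho i.
  by rewrite mulrCA [LHS]powRM //; [exact: ltW|rewrite mulr_ge0 // ltW].
by rewrite ts divfK ?gt_eqF // leNgt b'b.
Qed.

(** Packings of [E] are carried by [h] to packings of [F]. The scaling law is asked on [E] only,
    because [h] may be the inverse of a contraction, selected pointwise on an image. *)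
Lemma Phi_expanding E F h (k rho : R) : 0 < k -> 0 < rho ->
  (forall x, E x -> F (h x)) ->
  (forall x y, E x -> E y -> edist (h x) (h y) = k * edist x y) ->
  ((k `^ s)%:E * Phi s E rho <= Phi s F (k * rho))%E.
Proof.
move=> k0 rho0 EF hk.
have ks0 : 0 < k `^ s by exact: powR_gt0.
have F0 : (0 <= Phi s F (k * rho))%E by rewrite Phi_ge0 // mulr_gt0.
have [->|] := eqVneq (Phi s F (k * rho)) +oo%E; first by rewrite leey.
rewrite -ltey => Fy; have Ffin : Phi s F (k * rho) \is a fin_num.
  by rewrite ge0_fin_numE.
rewrite -(fineK Ffin) -lee_pdivlMl // -EFinM; apply: Phi_le.
  by rewrite mulr_ge0 ?fine_ge0 // invr_ge0 ltW.
move=> J x r Ex rr xr; rewrite ler_pdivlMl // -lee_fin fineK //.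
rewrite mulr_sumr.
have -> : \sum_i k `^ s * (2 * r i) `^ s = \sum_i (2 * (k * r i)) `^ s.
  apply: eq_bigr => i _; have /andP[ri0 _] := rr i.
  by rewrite [in RHS]mulrCA [RHS]powRM //; [exact: ltW|rewrite mulr_ge0 // ltW].
apply: (@Phi_ge _ _ _ (h \o x)) => //=.
- by rewrite mulr_gt0.
- by move=> i; exact: EF.
- by move=> i; have /andP[? ?] := rr i; rewrite mulr_gt0 //= ler_pM2l.
- by move=> i j ij /=; rewrite hk // -mulrDr ler_pM2l // xr.
Qed.

(* If packings drawn from the disjoint union of the well-separated cells are
   bounded by [b], so is the sum of the [Phi]'s: the union of packings of
   different cells is a packing. *)
Lemma sum_Phi_le (T : eqType) (cell : T -> set 'rV[R]_d) (rad : T -> R)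
    (l : seq T) (b : R) : uniq l -> (forall t, 0 < rad t) ->
  (forall t t' x y, t \in l -> t' \in l -> t <> t' ->
    cell t x -> cell t' y -> rad t + rad t' <= edist x y) ->
  (forall (J : finType) (x : J -> 'rV[R]_d) (r : J -> R),
    (forall i, exists2 t, t \in l & cell t (x i) /\ 0 < r i <= rad t) ->
    is_packing x r -> \sum_i (2 * r i) `^ s <= b) ->
  (\sum_(t <- l) Phi s (cell t) (rad t) <= b%:E)%E.
Proof.
move=> ul rad0 sep bnd.
(* Induction over the cells [l2] still to be treated, alongside a fixed packing drawn from the cells
   [l1] already opened. *)
suff : forall l1 l2, l = l1 ++ l2 ->
    forall (J : finType) (x : J -> 'rV[R]_d) (r : J -> R),
    (forall i, exists2 t, t \in l1 & cell t (x i) /\ 0 < r i <= rad t) ->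
    is_packing x r ->
    ((\sum_i (2 * r i) `^ s)%:E + \sum_(t <- l2) Phi s (cell t) (rad t) <= b%:E)%E.
  move=> /(_ [::] l erefl void (fun x => match x with end) (fun x => match x with end)).
  rewrite big1 => [|[]]; rewrite add0e; apply; first by case.
  by move=> [].
move=> l1 l2; elim: l2 l1 => [|t l2 IH] l1 ll J x r xl xr.
  rewrite big_nil adde0 lee_fin; apply: bnd xr => i.
  by have [t tl xt] := xl i; exists t => //; rewrite ll cats0.
have llt : l = rcons l1 t ++ l2 by rewrite cat_rcons.
have {}IH := IH _ llt.
have tl : t \in l by rewrite ll mem_cat mem_head orbT.
rewrite big_cons.
set X := (\sum_(t <- l2) _)%E in IH *.
have X0 : (0 <= X)%E by apply: sume_ge0 => j _; exact: Phi_ge0.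
have IH0 : ((\sum_i (2 * r i) `^ s)%:E + X <= b%:E)%E.
  apply: IH xr => i; have [t' t'l xt'] := xl i; exists t' => //.
  by rewrite mem_rcons inE t'l orbT.
have Xfin : X \is a fin_num.
  rewrite ge0_fin_numE //; apply: le_lt_trans (ltry b).
  by apply: le_trans IH0; rewrite leeDr // lee_fin sumr_ge0 // => i _; exact: powR_ge0.
rewrite -(fineK Xfin) in IH IH0 *.
rewrite -EFinD lee_fin in IH0.
(* By [Phi_le] it is enough to test packings [y] of this cell; glued to [x], such a packing falls
   under the induction hypothesis. *)
suff : (Phi s (cell t) (rad t) <= (b - (\sum_i (2 * r i) `^ s + fine X))%:E)%E.
  by rewrite EFinB leeBrDl // EFinD addeAC -addeA.
apply: Phi_le; first by rewrite subr_ge0.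
move=> Q y q yt qt yq.
have xy i j : r i + q j <= edist (x i) (y j).
  have [t' t'l [xt' /andP[_ rt']]] := xl i; have /andP[_ qj] := qt j.
  apply: le_trans (lerD rt' qj) _; apply: sep => //.
    by rewrite ll mem_cat t'l.
  move=> tt'; move: ul; rewrite ll cat_uniq => /and3P[_ /hasPn/(_ t)].
  by rewrite mem_head -tt' t'l => /(_ isT).
pose z (i : J + Q) := match i with inl i => x i | inr i => y i end.
pose p (i : J + Q) := match i with inl i => r i | inr i => q i end.
have := IH _ z p; rewrite big_sumType /= -EFinD lee_fin => {}IH.
rewrite lerBrDl addrAC; apply: IH.
  case=> i /=; last by exists t => //; rewrite mem_rcons mem_head.
  have [t' t'l xt'] := xl i; exists t' => //.
  by rewrite mem_rcons inE t'l orbT.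
case=> [i|i] [j|j] ij /=.
- by apply: xr => ij'; apply: ij; rewrite ij'.
- exact: xy.
- by rewrite addrC edistC xy.
- by apply: yq => ij'; apply: ij; rewrite ij'.
Qed.

End PhiTheory.

(** * Labelled covers *)

(* [M_delta s delta] and [M_infty s] are, by conversion, the instances where [P]
   is the interval of labels ]0, delta] and ]0, +oo[. *)
Definition M_radii (R : realType) (d : nat) (s : R) (P : R -> Prop)
    (F : set 'rV[R]_d) : \bar R :=
  ereal_inf [set c | exists (E : nat -> set 'rV[R]_d) (rho : nat -> R),
    [/\ F `<=` \bigcup_j E j,
        forall j, (ediam (E j) <= (rho j)%:E)%E,
        forall j, P (rho j) &
        c = (\sum_(0 <= j <oo) Phi s (E j) (rho j))%E]].

Section RadiiTheory.
Variables (R : realType) (d : nat) (s : R).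
Hypothesis s_gt0 : 0 < s.
Implicit Types (E F : set 'rV[R]_d) (rho : R) (P Q : R -> Prop).
Local Open Scope ereal_scope.

Lemma M_radii_ge0 P F : (forall r, P r -> (0 < r)%R) -> 0 <= M_radii s P F.
Proof.
move=> P0; apply/ereal_infP => _ [E [rho [_ _ Prho ->]]].
by apply: nneseries_ge0 => n _ _; exact/Phi_ge0/P0.
Qed.

Lemma M_radii_cover P F (T : countType) (E : T -> set 'rV[R]_d) (rho : T -> R)
    (r0 : R) (B : \bar R) : (forall r, P r -> (0 < r)%R) -> P r0 ->
  F `<=` \bigcup_t E t -> (forall t, ediam (E t) <= (rho t)%:E) ->
  (forall t, P (rho t)) ->
  (forall l : seq T, uniq l -> \sum_(t <- l) Phi s (E t) (rho t) <= B) ->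
  M_radii s P F <= B.
Proof.
move=> P0 Pr0 FE Erho Prho EB.
apply: le_trans (nneseries_pickle_le _ EB); last first.
  by move=> t; apply/Phi_ge0/P0/Prho.
apply: ereal_inf_lbound.
exists (fun n => oapp E set0 (pickle_inv n)), (fun n => oapp rho r0 (pickle_inv n)).
split.
- move=> x /FE [t _ Etx]; exists (pickle t) => //.
  by rewrite pickleK_inv.
- move=> j; case: pickle_inv => //=.
  by rewrite ediam_set0 lee_fin ltW // P0.
- by move=> j; case: pickle_inv => //=.
- by congr (limn _); apply/funext => n; apply: eq_bigr => i _;
    case: pickle_inv => //=; rewrite Phi_set0.
Qed.

Lemma M_radii_set0 P r0 : (forall r, P r -> (0 < r)%R) -> P r0 ->
  M_radii s P (set0 : set 'rV[R]_d) = 0.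
Proof.
move=> P0 Pr0; apply/eqP; rewrite eq_le M_radii_ge0 // andbT.
apply: (@M_radii_cover _ _ void (fun t => match t with end)
  (fun t => match t with end) r0) => //; try by case.
by case=> [|[]] _; rewrite big_nil.
Qed.

Lemma M_radii_subset P E F : (forall r, P r -> (0 < r)%R) -> E `<=` F ->
  M_radii s P E <= M_radii s P F.
Proof.
move=> P0 EF; apply: ereal_inf_le_tmp => _ [G [rho [FG Grho Prho ->]]].
by exists G, rho; split => //; exact: subset_trans FG.
Qed.

Lemma M_radii_le_radii P Q F : (forall r, P r -> Q r) ->
  M_radii s Q F <= M_radii s P F.
Proof.
move=> PQ; apply: ereal_inf_le_tmp => _ [G [rho [FG Grho Prho ->]]].
by exists G, rho; split => // j; exact: PQ.
Qed.

(** A cover of [F] is pulled back along [h], its labels being divided by [k]; [Phi_expanding]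
    compares the costs term by term. *)
Lemma M_radii_expanding P Q E F h (k : R) : (0 < k)%R ->
  (forall r, P r -> (0 < r)%R) -> (forall r, Q r -> P (r / k)%R) ->
  (forall x, E x -> F (h x)) ->
  (forall x y, E x -> E y -> edist (h x) (h y) = k * edist x y)%R ->
  (k `^ s)%:E * M_radii s P E <= M_radii s Q F.
Proof.
move=> k0 P0 QP EF hk.
apply/ereal_infP => _ [G [rho [FG Grho Qrho ->]]].
have ks0 : (0 < k `^ s)%R by exact: powR_gt0.
pose H j := E `&` h @^-1` G j.
have Hrho j : (0 < rho j / k)%R by exact/P0/QP.
have rk j : (k * (rho j / k) = rho j)%R by rewrite mulrC divfK // gt_eqF.
apply: (@le_trans _ _ (\sum_(0 <= j <oo) (k `^ s)%:E * Phi s (H j) (rho j / k))).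
  rewrite nneseriesZl => [|j _]; last exact: Phi_ge0.
  rewrite lee_pmul2l //; apply: ereal_inf_lbound; exists H, (fun j => rho j / k)%R.
  split=> //.
  - by move=> x Ex; have [j _ Gjx] := FG _ (EF _ Ex); exists j.
  - move=> j; apply: (@ediam_le_expanding _ _ _ (G j) h k) => //.
    + by rewrite ltW.
    + by move=> x [].
    + by move=> x y [Ex _] [Ey _]; exact: hk.
    + by rewrite rk.
  - by move=> j; exact: QP.
apply: lee_nneseries => j _.
  by rewrite mule_ge0 ?Phi_ge0 // lee_fin ltW.
rewrite -[X in Phi s (G j) X]rk; apply: (Phi_expanding s_gt0 (h := h)) => //.
- by move=> x [].
- by move=> x y [Ex _] [Ey _]; exact: hk.
Qed.

Lemma M_radii_setU P E F : (forall r, P r -> (0 < r)%R) ->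
  M_radii s P (E `|` F) <= M_radii s P E + M_radii s P F.
Proof.
move=> P0.
have E0 := M_radii_ge0 E P0; have F0 := M_radii_ge0 F P0.
have [->|] := eqVneq (M_radii s P E) +oo; first by rewrite addye ?leey // -ltNye (lt_le_trans _ F0).
have [->|] := eqVneq (M_radii s P F) +oo; first by rewrite addey ?leey // -ltNye (lt_le_trans _ E0).
rewrite -!ltey -!ge0_fin_numE // => Ffin Efin.
apply/lee_addgt0Pr => e e0.
have e2 : (0 < e / 2)%R by rewrite divr_gt0.
have [_ [G [rho [EG Grho Prho ->]]] cE] := lb_ereal_inf_adherent e2 Efin.
have [_ [H [rho' [FH Hrho Prho' ->]]] cF] := lb_ereal_inf_adherent e2 Ffin.
apply: le_trans (_ : \sum_(0 <= j <oo) Phi s (G j) (rho j) +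
  \sum_(0 <= j <oo) Phi s (H j) (rho' j) <= _); last first.
  by rewrite [e]splitr EFinD addeACA leeD // ltW.
pose K (t : nat + nat) := match t with inl j => G j | inr j => H j end.
pose r (t : nat + nat) := match t with inl j => rho j | inr j => rho' j end.
apply: (@M_radii_cover _ _ (nat + nat)%type K r (rho 0%N)) => //.
- move=> x [/EG [j _ ?]|/FH [j _ ?]]; first by exists (inl j).
  by exists (inr j).
- by case.
- by case.
move=> l ul.
pose getl (t : nat + nat) := if t is inl j then Some j else None.
pose getr (t : nat + nat) := if t is inr j then Some j else None.
apply: (@le_trans _ _ (\sum_(j <- pmap getl l) Phi s (G j) (rho j) +
  \sum_(j <- pmap getr l) Phi s (H j) (rho' j))).
  rewrite !big_pmap -big_split /= le_eqVlt; apply/orP; left; apply/eqP.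
  by apply: eq_bigr => -[j|j] _ /=; rewrite ?adde0 ?add0e.
apply: leeD; apply: nneseries_sum_ge.
- by apply: (pmap_uniq (g := inl)) ul; case.
- by move=> n; exact/Phi_ge0/P0.
- by apply: (pmap_uniq (g := inr)) ul; case.
- by move=> n; exact/Phi_ge0/P0.
Qed.

Lemma M_radii_bigcup P (J : finType) (E : J -> set 'rV[R]_d) F r0 :
  (forall r, P r -> (0 < r)%R) -> P r0 ->
  M_radii s P (\bigcup_j E j `|` F) <= \sum_j M_radii s P (E j) + M_radii s P F.
Proof.
move=> P0 Pr0.
suff : forall l : seq J, M_radii s P ([set x | exists2 j, j \in l & E j x] `|` F)
    <= \sum_(j <- l) M_radii s P (E j) + M_radii s P F.
  move=> /(_ (index_enum J)); apply: le_trans; apply: M_radii_subset => //.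
  by apply: setSU => x [j _ Ejx]; exists j => //; exact: mem_index_enum.
elim=> [|j l IH].
  rewrite big_nil add0e; apply: M_radii_subset => // x [[j]|//].
  by rewrite in_nil.
rewrite big_cons -addeA; apply: le_trans (leeD2l _ IH).
apply: le_trans (M_radii_setU _ _ P0); apply: M_radii_subset => // x.
case=> [[i]|Fx]; last by right; right.
by rewrite inE => /predU1P[->|il Ex]; [left|right; left; exists i].
Qed.

End RadiiTheory.

(** * Sets on which the labelled packing quantities agree *)

Section Regular.
Variables (R : realType) (d : nat) (s : R).
Hypothesis s_gt0 : 0 < s.
Implicit Types (E F : set 'rV[R]_d).

(** The reverse inequality is automatic, since restricting the labels leaves fewer covers. With
    finiteness this yields all the equalities, see [M_stableP]. *)
Definition M_stable F :=
  (forall delta, 0 < delta -> (M_delta s delta F <= M_infty s F)%E) /\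
  (M_infty s F < +oo)%E.

Lemma M_stableP F : M_stable F -> forall delta, 0 < delta ->
  [/\ M_infty s F = M_delta s delta F, M_delta s delta F = M_measure s F &
      (M_measure s F < +oo)%E].
Proof.
move=> [le_infty ltyF].
have E delta : 0 < delta -> M_infty s F = M_delta s delta F.
  move=> delta0; apply/eqP; rewrite eq_le le_infty // andbT.
  by apply: (@M_radii_le_radii _ _ s (fun r => is_true (0 < r <= delta))
    (fun r => is_true (0 < r))) => r /andP[].
have Mm : M_measure s F = M_infty s F.
  apply/eqP; rewrite eq_le; apply/andP; split.
    by apply/ereal_supP => _ [e /andP[e0 _] <-]; exact: le_infty.
  apply: ereal_sup_ubound; exists 2^-1; last by rewrite -E.
  by rewrite /= invr_gt0 invf_lt1 ?ltr1n // ltr0n.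
by move=> delta delta0; rewrite Mm -E.
Qed.

(* A nonempty set labelled [r] costs at least [(2 * r) `^ s], so the labels of a
   cover of finite cost are bounded. *)
Lemma M_delta_le_cover F (E : nat -> set 'rV[R]_d) (rho : nat -> R) :
  F `<=` \bigcup_j E j -> (forall j, (ediam (E j) <= (rho j)%:E)%E) ->
  (forall j, 0 < rho j) -> (\sum_(0 <= j <oo) Phi s (E j) (rho j) < +oo)%E ->
  exists2 r, 0 < r &
    (M_delta s r F <= \sum_(0 <= j <oo) Phi s (E j) (rho j))%E.
Proof.
move=> FE Erho rho0; set theta := (\sum_(0 <= j <oo) _)%E => theta_lty.
have Phi0 j : (0 <= Phi s (E j) (rho j))%E by exact: Phi_ge0.
have theta0 : (0 <= theta)%E by apply: nneseries_ge0.
have theta_fin : theta \is a fin_num by rewrite ge0_fin_numE.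
(* A nonempty set of label above [r] would alone cost more than theta; adding 1 keeps [r] positive
   when theta is 0. *)
pose r : R := fine theta `^ s^-1 + 1.
have r0 : 0 < r by rewrite ltr_wpDl ?powR_ge0.
have rho_r j : E j != set0 -> rho j <= r.
  case/set0P => y Ey; rewrite leNgt; apply/negP => rj.
  have : (((2 * rho j) `^ s)%:E <= theta)%E.
    apply: le_trans (Phi_ge_radius s (rho0 j) Ey) _.
    by apply: le_trans (nneseries_sum_ge (l := [:: j]) _ Phi0);
      rewrite ?big_seq1.
  rewrite -(fineK theta_fin) lee_fin leNgt => /negP; apply.
  have -> : fine theta = (fine theta `^ s^-1) `^ s.
    by rewrite -powRrM mulVf ?gt_eqF // powRr1 // fine_ge0.
  apply: gt0_ltr_powR => //; rewrite ?nnegrE ?powR_ge0 //.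
    by rewrite mulr_ge0 // ltW.
  by rewrite /r in rj; have := rho0 j; lra.
exists r => //.
apply: ereal_inf_lbound.
(* Empty sets may carry labels above [r]; relabelling them does not change the cost. *)
exists E, (fun j => if E j == set0 then r else rho j); split => //.
- by move=> j; case: eqP => [->|//]; rewrite ediam_set0 lee_fin ltW.
- move=> j; case: ifPn => [_|Ej]; first by rewrite r0 lexx.
  by rewrite rho0 rho_r.
- congr (limn _); apply/funext => n; apply: eq_bigr => j _.
  by case: eqP => // ->; rewrite !Phi_set0.
Qed.

Lemma M_stable_set0 : M_stable set0.
Proof.
have i0 : M_infty s (set0 : set 'rV[R]_d) = 0%E.
  exact: (@M_radii_set0 _ _ s (fun r => is_true (0 < r)) 1).
split=> [delta delta0|]; rewrite i0 //.
rewrite le_eqVlt; apply/orP; left; apply/eqP.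
apply: (@M_radii_set0 _ _ s (fun r => is_true (0 < r <= delta)) delta) => [r /andP[]//|].
by rewrite delta0 lexx.
Qed.

(** Both quantities scale by k^s, the scale delta of [F] corresponding to delta / k of [E]. *)
Lemma M_stable_similar E F h h' (k : R) : 0 < k ->
  (forall x, E x -> F (h x)) ->
  (forall x y, E x -> E y -> edist (h x) (h y) = k * edist x y) ->
  (forall x, F x -> E (h' x)) ->
  (forall x y, F x -> F y -> edist (h' x) (h' y) = k^-1 * edist x y) ->
  M_stable E -> M_stable F.
Proof.
move=> k0 EF hk FE hk' [le_infty lty].
have k'0 : 0 < k^-1 by rewrite invr_gt0.
have ks0 : 0 < k `^ s by exact: powR_gt0.
have inf1 : ((k `^ s)%:E * M_infty s E <= M_infty s F)%E.
  apply: (M_radii_expanding (P := fun r => is_true (0 < r))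
    (Q := fun r => is_true (0 < r)) s_gt0 k0 _ _ EF hk) => // r r0.
  by rewrite divr_gt0.
have ksV : (k^-1) `^ s = (k `^ s)^-1 by rewrite powRVl // ltW.
split.
  move=> delta delta0; apply: le_trans inf1.
  rewrite -lee_pdivrMl // -ksV.
  apply: le_trans (le_infty (delta / k) (divr_gt0 delta0 k0)).
  apply: (M_radii_expanding (P := fun r => is_true (0 < r <= delta))
    (Q := fun r => is_true (0 < r <= delta / k)) s_gt0 k'0 _ _ FE hk')
    => r /andP[r0 rd] //.
  by rewrite invrK mulr_gt0 //= -ler_pdivlMr.
have : ((k^-1 `^ s)%:E * M_infty s F <= M_infty s E)%E.
  apply: (M_radii_expanding (P := fun r => is_true (0 < r))
    (Q := fun r => is_true (0 < r)) s_gt0 k'0 _ _ FE hk') => // r r0.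
  by rewrite divr_gt0.
rewrite ksV lee_pdivrMl // => /le_lt_trans; apply.
by rewrite lte_mul_pinfty // lee_fin ltW.
Qed.

End Regular.

(** * Separated families of similarities *)

(** Compactness in a form suited to covers by arbitrary sets: once each [U j] is thickened by [e j],
    finitely many of them suffice. *)
Definition edist_compact (R : realType) (d : nat) (K : set 'rV[R]_d) : Prop :=
  forall (U : nat -> set 'rV[R]_d) (e : nat -> R), (forall j, 0 < e j) ->
    K `<=` \bigcup_j U j ->
  exists n, forall x, K x ->
    exists j, [/\ (j < n)%N & exists2 y, U j y & edist x y < e j].

Lemma sum_at_most_one (R : numDomainType) (J : finType) (P : pred J) (c : R) :
  0 <= c -> (forall i j, P i -> P j -> i = j) -> \sum_(j | P j) c <= c.
Proof.
move=> c0 P1; have [i Pi|P0] := pickP P; last by rewrite big_pred0.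
rewrite (bigD1 i) //= big1 ?addr0 // => j /andP[Pj] /eqP ji.
by case: ji; exact: P1.
Qed.

(** With [m] a positive lower bound below 1 of the ratios, raising the exponent by less than [e]
    multiplies each term by at least m^e, and [e] is chosen so that m^e is the inverse of the sum at
    [s]. *)
Lemma exists_powR_ge1 (R : realType) (J : finType) (q : J -> R) (s : R) :
  (forall j, 0 < q j < 1) -> 1 < \sum_j q j `^ s ->
  exists2 e, 0 < e & forall u, u < s + e -> 1 <= \sum_j q j `^ u.
Proof.
move=> q01; set T := \sum_j _ => T1.
pose m := \big[Order.min/2^-1]_j q j.
have m0 : 0 < m.
  apply/bigmin_gtP; split=> [|j _]; first by rewrite invr_gt0.
  by have /andP[] := q01 j.
have m1 : m < 1.
  by apply: le_lt_trans (bigmin_le_id _ _ _ _) _; rewrite invf_lt1 ?ltr1n.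
have lnm : 0 < - ln m by rewrite oppr_gt0 ln_lt0 // m0.
have T0 : 0 < T by exact: lt_trans T1.
have lnT : 0 < ln T by rewrite ln_gt0.
set e := ln T / (- ln m).
have e0 : 0 < e by rewrite divr_gt0.
have me : m `^ e = T^-1.
  rewrite /powR gt_eqF //.
  have -> : e * ln m = - ln T.
    by rewrite /e; field; rewrite -oppr_eq0 gt_eqF.
  by rewrite expRN lnK // posrE.
exists e => // u us.
have -> : 1 = T * T^-1 :> R by rewrite divff // gt_eqF.
rewrite mulr_suml; apply: ler_sum => j _.
have /andP[qj0 qj1] := q01 j.
rewrite -me; apply: (@le_trans _ _ (q j `^ s * q j `^ e)).
  rewrite ler_wpM2l ?powR_ge0 //; apply: le_powR2l; [exact: ltW|exact: ltW|].
  exact: bigmin_le.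
rewrite -powRD; last by rewrite (gt_eqF qj0) implybT.
by apply: ger_powR; rewrite ?qj0 ?ltW.
Qed.

Section Falconer.
Variables (R : realType) (d : nat) (K : set 'rV[R]_d).
Variables (J : finType) (f : J -> 'rV[R]_d -> 'rV[R]_d) (q : J -> R) (eta : R).
Hypothesis K_neq0 : K !=set0.
Hypothesis q01 : forall j, 0 < q j < 1.
Hypothesis f_sim : forall j, is_similarity (q j) (f j).
Hypothesis fK : forall j x, K x -> K (f j x).
Hypothesis eta_gt0 : 0 < eta.
Hypothesis f_sep : forall i j x y, i <> j -> K x -> K y ->
  eta <= edist (f i x) (f j y).

(* Pulling a cover back along each [f j] splits it into covers with fewer sets:
   a set of diameter less than [eta] meets at most one image [f j @` K]. *)
Lemma finite_cover_powR_ge (T : finType) (u : R) : 0 < u ->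
  1 <= \sum_j q j `^ u -> forall (A : {set T}) (U : T -> set 'rV[R]_d) (b : T -> R),
  (forall t, 0 <= b t) ->
  (forall t x y, K x -> K y -> U t x -> U t y -> edist x y <= b t) ->
  (forall x, K x -> exists2 t, t \in A & U t x) ->
  eta `^ u <= \sum_(t in A) b t `^ u.
Proof.
move=> u0 qu A; have [n] := ubnP #|A|; elim: n A => // n IH A An U b b0 Ub KU.
have [x0 Kx0] := K_neq0.
(* A set of bound at least [eta] pays for the estimate alone; from here on all bounds are
   smaller. *)
have [[t tA bt]|small] := pselect (exists2 t, t \in A & eta <= b t).
  rewrite (bigD1 t) //=; apply: (@le_trans _ _ (b t `^ u)).
    by apply: le_powR2l => //; exact: ltW.
  by rewrite lerDl sumr_ge0 // => i _; exact: powR_ge0.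
(* A single ratio has q^u < 1, so there are at least two maps. Some set of the cover then meets
   another image, and the pulled-back cover is strictly smaller. *)
have other j : exists i : J, i <> j.
  apply/not_existsP => J1.
  have /(le_trans qu) : \sum_i q i `^ u <= q j `^ u.
    rewrite (bigD1 j) //= big1 ?addr0 // => i /eqP ij.
    by have := J1 i.
  have /andP[qj0 qj1] := q01 j.
  rewrite leNgt => /negP; apply; have -> : 1 = 1 `^ u :> R by rewrite powR1.
  by apply: gt0_ltr_powR; rewrite // nnegrE ltW.
pose Aj j := [set t in A | `[< exists2 x, K x & U t (f j x) >]]%SET.
have Aj_uniq t i j : t \in Aj i -> t \in Aj j -> i = j.
  rewrite !inE => /andP[tA /asboolP[x Kx Ux]] /andP[_ /asboolP[y Ky Uy]].
  apply: contrapT => ij; apply: small; exists t => //.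
  by apply: le_trans (f_sep ij Kx Ky) _; apply: Ub => //; exact: fK.
have q0 j : 0 < q j by have /andP[] := q01 j.
have step j : q j `^ u * eta `^ u <= \sum_(t in Aj j) b t `^ u.
  have qju : 0 < q j `^ u by exact: powR_gt0.
  rewrite -ler_pdivlMl // mulr_sumr.
  have -> : \sum_(t in Aj j) (q j `^ u)^-1 * b t `^ u =
      \sum_(t in Aj j) ((q j)^-1 * b t) `^ u.
    apply: eq_bigr => t _; rewrite powRM ?invr_ge0 ?(ltW (q0 j)) //.
    by rewrite powRVl ?(ltW (q0 j)).
  apply: (IH _ _ (fun t => f j @^-1` U t)).
  - rewrite -ltnS; apply: leq_trans An; rewrite ltnS; apply: proper_card.
    apply/properP; split; first by apply/fintype.subsetP => t; rewrite inE => /andP[].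
    have [i ij] := other j; have [t tA Ut] := KU _ (fK i Kx0).
    exists t => //; apply/negP => tj; apply: ij; apply: Aj_uniq tj.
    by rewrite inE tA; apply/asboolP; exists x0.
  - by move=> t; rewrite mulr_ge0 ?invr_ge0 ?(ltW (q0 j)).
  - move=> t x y Kx Ky Ux Uy; rewrite ler_pdivlMl // -f_sim.
    by apply: Ub => //; exact: fK.
  - move=> x Kx; have [t tA Ut] := KU _ (fK j Kx); exists t => //.
    by rewrite inE tA; apply/asboolP; exists x.
apply: (@le_trans _ _ (\sum_j q j `^ u * eta `^ u)).
  by rewrite -mulr_suml ler_peMl ?powR_ge0.
apply: le_trans (ler_sum _ (fun j _ => step j)) _.
(* Each set of the cover is used for at most one [j], so the sums over the [Aj j] add up to at most
   the sum over [A]. *)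
rewrite (exchange_big_dep (mem A)) /=; last first.
  by move=> j t _; rewrite inE => /andP[].
apply: ler_sum => t tA; apply: sum_at_most_one; first exact: powR_ge0.
by move=> i j; exact: Aj_uniq.
Qed.

(** A cover of cost below half of eta^u is thickened at an extra cost of at most the other half.
    Compactness makes it finite, against [finite_cover_powR_ge]. *)
Lemma hausdorff_measure_neq0 (u : R) : edist_compact K -> 0 < u ->
  1 <= \sum_j q j `^ u -> hausdorff_measure u K <> 0%E.
Proof.
move=> Kc u0 qu H0.
pose kap := eta `^ u / 2.
have etau : 0 < eta `^ u by exact: powR_gt0.
have kap0 : 0 < kap by rewrite divr_gt0.
have : (hausdorff_content u 1 K < kap%:E)%E.
  apply: (@le_lt_trans _ _ 0%E); last by rewrite lte_fin.
  by rewrite -H0; apply: ereal_sup_ubound; exists 1 => //=.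
move=> /ereal_inf_lt[_ [E [KE E1 ->]] Ekap].
pose b j := fine (ediam (E j)).
have bE j : ediam (E j) = (b j)%:E.
  rewrite fineK // ge0_fin_numE ?ediam_ge0 //; exact: le_lt_trans (E1 j) (ltry _).
have b0 j : 0 <= b j by rewrite -lee_fin -bE ediam_ge0.
have costE j : hausdorff_cost u (E j) = (b j `^ u)%:E.
  rewrite /hausdorff_cost; case: eqP => [Ej|_]; last by rewrite bE poweR_EFin.
  by rewrite /b Ej ediam_set0 powR0 // gt_eqF.
pose w j : R := kap / (2 ^ j.+1)%:R.
have w0 j : 0 < w j by rewrite divr_gt0 // ltr0n expn_gt0.
pose b' j := (b j `^ u + w j) `^ u^-1.
have b'u j : b' j `^ u = b j `^ u + w j.
  by rewrite /b' -powRrM mulVf ?gt_eqF // powRr1 // addr_ge0 ?powR_ge0 ?ltW.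
have bb' j : b j < b' j.
  rewrite ltNge; apply/negP => /(le_powR2l (ltW u0) (powR_ge0 _ _)).
  by rewrite b'u gerDl leNgt w0.
(* Thickening by [e j] raises the diameter bound from [b j] to [b' j]. *)
pose e j := (b' j - b j) / 2.
have e0 j : 0 < e j by rewrite divr_gt0 ?subr_gt0.
have [n nP] := Kc E e e0 KE.
have : eta `^ u <= \sum_(j in [set: 'I_n]%SET) b' j `^ u.
  apply: (finite_cover_powR_ge u0 qu
    (U := fun j : 'I_n => [set x | exists2 y, E j y & edist x y < e j])).
  - by move=> j; exact: powR_ge0.
  - move=> j x y _ _ [x' Ex' xx'] [y' Ey' yy'].
    have h1 := edist_triangle x' x y; have h2 := edist_triangle y' x' y.
    rewrite (edistC y' y) in h2.
    have h3 : edist x' y' <= b j by apply: edist_le_ediam Ex' Ey'; rewrite bE.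
    by rewrite /e in xx' yy'; lra.
  - by move=> x /nP[j [jn jx]]; exists (Ordinal jn).
apply/negP; rewrite -ltNge.
under eq_bigr do rewrite b'u.
rewrite big_split /= (_ : eta `^ u = kap + kap); last by rewrite /kap -splitr.
have sumT (F : nat -> R) : (\sum_(j in [set: 'I_n]%SET) F j) = \sum_(0 <= j < n) F j.
  by rewrite big_mkord; apply: eq_bigl => j; rewrite inE.
apply: ltr_leD.
  rewrite (sumT (fun j => b j `^ u)) -lte_fin; apply: le_lt_trans Ekap.
  rewrite -sumEFin; under eq_bigr do rewrite -costE.
  apply: nneseries_lim_ge => j _ _; rewrite costE lee_fin powR_ge0 //.
rewrite (sumT w) -lee_fin; apply: le_trans (epsilon_trick0 xpredT (ltW kap0)).
rewrite -sumEFin.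
by apply: nneseries_lim_ge => j _ _; rewrite lee_fin ltW // w0.
Qed.

(** The dimension enters through exponents [u] just above [s] of zero measure: a sum above 1 at [s]
    would still be at least 1 at such a [u]. *)
Lemma sum_powR_le1 (s : R) : edist_compact K -> 0 < s ->
  (forall e, 0 < e -> exists2 u, s <= u < s + e & hausdorff_measure u K = 0%E) ->
  \sum_j q j `^ s <= 1.
Proof.
move=> Kc s0 Kdim; rewrite leNgt; apply/negP => /(exists_powR_ge1 q01)[e e0 He].
have [u /andP[su ue] Hu] := Kdim e e0.
by apply: hausdorff_measure_neq0 Hu => //; [exact: lt_le_trans su|exact: He].
Qed.

End Falconer.

(** * Grid cells *)

Section Grid.
Variables (R : realType) (d : nat).
Implicit Types (x y : 'rV[R]_d) (h : R).

Definition grid_index h x : {ffun 'I_d -> int} :=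
  [ffun k => Num.floor (x 0 k / h)].

Definition grid_colour (m : nat) (z : {ffun 'I_d -> int}) : {ffun 'I_d -> 'I_m.+1} :=
  [ffun k => inord `|(z k %% m.+1)%Z|%N].

Lemma grid_index_edist h x y : 0 < h -> grid_index h x = grid_index h y ->
  edist x y <= d%:R * h.
Proof.
move=> h0 /ffunP xy; apply: edist_le_sup => k.
have := xy k; rewrite !ffunE => fxy.
have /andP[x1 x2] := floor_itv (x 0 k / h).
have /andP[y1 y2] := floor_itv (y 0 k / h).
rewrite fxy in x1 x2; rewrite intrD in x2 y2.
rewrite !ler_pdivlMr // in x1 y1; rewrite !ltr_pdivrMr // in x2 y2.
rewrite ler_norml; apply/andP; split; nra.
Qed.

Lemma modz_neq_dist (a b m : int) : 0 < m -> (a %% m)%Z = (b %% m)%Z -> a <> b ->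
  m <= `|a - b|.
Proof.
move=> m0 /eqP; rewrite eqz_mod_dvd => mab ab.
have : (`|m| <= `|a - b|)%N.
  by apply: dvdn_leq => //; rewrite absz_gt0 subr_eq0; exact/eqP.
by rewrite -lez_nat -!abszE gtz0_abs.
Qed.

(** Some index differs by a nonzero multiple of m + 1, and rounding down loses less than one mesh
    width. *)
Lemma grid_colour_edist h m x y : 0 < h ->
  grid_colour m (grid_index h x) = grid_colour m (grid_index h y) ->
  grid_index h x <> grid_index h y -> m%:R * h <= edist x y.
Proof.
move=> h0 /ffunP cxy nxy.
have [k nk] : exists k, grid_index h x k <> grid_index h y k.
  by apply/existsNP => xy; apply: nxy; apply/ffunP.
apply: le_trans (ler_coord_edist x y k).
have m0 : (0 : int) < m.+1 by [].
have mE (a : int) : ((inord `|(a %% m.+1)%Z|%N : 'I_m.+1) : int) = (a %% m.+1)%Z.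
  have a0 : 0 <= (a %% m.+1)%Z by rewrite modz_ge0.
  rewrite inordK ?gez0_abs // -ltz_nat gez0_abs //; exact: ltz_pmod.
have := cxy k; rewrite [LHS]ffunE [RHS]ffunE => /(congr1 (fun i : 'I_m.+1 => (i : int))).
rewrite !mE => mxy; have := modz_neq_dist m0 mxy nk.
rewrite !ffunE.
have /andP[x1 x2] := floor_itv (x 0 k / h).
have /andP[y1 y2] := floor_itv (y 0 k / h).
move: (Num.floor (x 0 k / h)) (Num.floor (y 0 k / h)) x1 x2 y1 y2 => a b x1 x2 y1 y2.
rewrite -(ler_int R) intr_norm intrB => ab.
rewrite intrD in x2; rewrite intrD in y2.
rewrite ler_pdivlMr // in x1; rewrite ler_pdivlMr // in y1.
rewrite ltr_pdivrMr // in x2; rewrite ltr_pdivrMr // in y2.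
have mm : (m.+1 : int)%:~R = m%:R + 1 :> R by rewrite -pmulrn -natr1.
rewrite mm ler_normr in ab; rewrite ler_normr.
case/orP : ab => ab; apply/orP; [left|right]; nra.
Qed.

End Grid.

(** * Sets with small copies at every point *)

Section Zoom.
Variables (R : realType) (d : nat) (K : set 'rV[R]_d) (s c R0 : R).
Hypothesis s_gt0 : 0 < s.
Hypothesis K_neq0 : K !=set0.
Hypothesis K_compact : edist_compact K.
Hypothesis c_gt0 : 0 < c.
Hypothesis R0_gt0 : 0 < R0.
Hypothesis K_diam : forall x y, K x -> K y -> edist x y <= R0.
Hypothesis K_zoom : forall x r, K x -> 0 < r <= R0 ->
  exists q f, [/\ c * r <= q <= r, q < 1, is_similarity q f &
    forall y, K y -> K (f y) /\ edist x (f y) <= r].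
Hypothesis K_dim : forall e, 0 < e ->
  exists2 u, s <= u < s + e & hausdorff_measure u K = 0%E.

Definition separated_family (J : finType) (q : J -> R)
    (f : J -> 'rV[R]_d -> 'rV[R]_d) : Prop :=
  [/\ forall j, 0 < q j < 1, forall j, is_similarity (q j) (f j),
      forall j x, K x -> K (f j x) &
      exists2 eta, 0 < eta &
        forall i j x y, i <> j -> K x -> K y -> eta <= edist (f i x) (f j y)].

Lemma separated_family_le1 (J : finType) (q : J -> R) f :
  separated_family q f -> \sum_j q j `^ s <= 1.
Proof.
case=> q01 fsim fK [eta eta0 fsep].
exact: (sum_powR_le1 K_neq0 q01 fsim fK eta0 fsep).
Qed.

(* Each ball of the packing receives a copy of [K] of comparable size within
   half its radius, so the copies are separated from each other and from
   whatever the balls avoid. *)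
Lemma separated_family_extend (J P : finType) (q : J -> R) f
    (x : P -> 'rV[R]_d) (r : P -> R) :
  separated_family q f -> (forall i, K (x i)) -> (forall i, 0 < r i <= R0) ->
  is_packing x r -> (forall i j y, K y -> r i <= edist (x i) (f j y)) ->
  exists (q' : P -> R) f',
    [/\ separated_family (fun k : J + P => match k with inl j => q j | inr i => q' i end)
          (fun k : J + P => match k with inl j => f j | inr i => f' i end),
        forall i, q' i <= r i &
        \sum_i (2 * r i) `^ s <= (4 / c) `^ s * \sum_i q' i `^ s].
Proof.
case=> q01 fsim fK [eta eta0 fsep] Kx rR0 xr xf.
have r0 i : 0 < r i by have /andP[] := rR0 i.
(* Zooming at half the radius keeps the copy within [r i / 2] of the centre and leaves the other
   half as a gap. *)
have /choice[g gP] i : exists g : R * ('rV[R]_d -> 'rV[R]_d),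
  [/\ c * (r i / 2) <= g.1 <= r i / 2, g.1 < 1, is_similarity g.1 g.2 &
    forall y, K y -> K (g.2 y) /\ edist (x i) (g.2 y) <= r i / 2].
  have /andP[ri0 riR] := rR0 i.
  have ri2 : 0 < r i / 2 <= R0 by apply/andP; split; lra.
  by have [q' [f' h]] := K_zoom (Kx i) ri2; exists (q', f').
exists (fun i => (g i).1), (fun i => (g i).2); split.
- pose e := \big[Order.min/eta]_i (r i / 2).
  have er i : e <= r i / 2 by exact: bigmin_le.
  have inter i k y z : K y -> K z -> e <= edist (f k y) ((g i).2 z).
    move=> Ky Kz; have [_ _ _ /(_ z Kz)[_ gz]] := gP i.
    have := xf i k y Ky; have := edist_triangle ((g i).2 z) (x i) (f k y).
    rewrite (edistC ((g i).2 z)) => h1 h2.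
    by have := er i; lra.
  split.
  + case=> [j|i]; first exact: q01.
    have [/andP[q1 q2] q3 _ _] := gP i; rewrite q3 andbT.
    by apply: lt_le_trans q1; rewrite mulr_gt0 // divr_gt0.
  + by case=> [j|i]; [exact: fsim|have [] := gP i].
  + case=> [j|i] y Ky; first exact: fK.
    by have [_ _ _ /(_ y Ky)[]] := gP i.
  + exists e.
      by apply/bigmin_gtP; split=> // i _; rewrite divr_gt0.
    case=> [j|i] [k|l] y z jk Ky Kz.
    * apply: le_trans (fsep _ _ _ _ _ Ky Kz); first exact: bigmin_le_id.
      by move=> jk'; apply: jk; rewrite jk'.
    * exact: inter.
    * by rewrite edistC; exact: inter.
    * have il : i <> l by move=> il; apply: jk; rewrite il.
      have [_ _ _ /(_ y Ky)[_ gy]] := gP i.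
      have [_ _ _ /(_ z Kz)[_ gz]] := gP l.
      have h1 := edist_triangle ((g i).2 y) (x i) (x l).
      have h2 := edist_triangle ((g l).2 z) ((g i).2 y) (x l).
      rewrite (edistC ((g l).2 z)) in h2.
      by have := xr _ _ il; have := er i; have := r0 l; lra.
- move=> i; have [/andP[_ qr] _ _ _] := gP i.
  by have := r0 i; lra.
(* The copy has ratio at least c r / 2, hence 2 r is at most 4 / c times that ratio. *)
- rewrite mulr_sumr; apply: ler_sum => i _.
  have [/andP[cq _] _ _ _] := gP i.
  have c4 : 0 <= 4 / c by rewrite divr_ge0 // ltW.
  have rq : 0 <= c * (r i / 2) by rewrite mulr_ge0 ?ltW // divr_gt0.
  rewrite -powRM //; last exact: le_trans cq.
  apply: le_powR2l; [exact: ltW|by rewrite mulr_ge0 // ltW|].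
  rewrite mulrAC ler_pdivlMr //; lra.
Qed.

(** The packing extends the empty family, and the resulting family has sum at most 1. *)
Lemma packing_sum_le (P : finType) (x : P -> 'rV[R]_d) (r : P -> R) :
  (forall i, K (x i)) -> (forall i, 0 < r i <= R0) -> is_packing x r ->
  \sum_i (2 * r i) `^ s <= (4 / c) `^ s.
Proof.
move=> Kx rR0 xr.
have W0 : separated_family (fun t : void => match t with end)
    (fun t : void => match t with end).
  by split; [case|case|case|exists 1 => //; case].
have [q' [f' [fam _ /le_trans]]] := separated_family_extend W0 Kx rR0 xr
  (fun i (j : void) => match j with end).
apply; rewrite ler_piMr ?powR_ge0 //.
have := separated_family_le1 fam; rewrite big_sumType /= big1 ?add0r //.
Qed.

Lemma Phi_lty : (Phi s K R0 <= ((4 / c) `^ s)%:E)%E.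
Proof.
apply: Phi_le => //; first exact: powR_ge0.
by move=> P x r; exact: packing_sum_le.
Qed.

Lemma M_infty_lty : (M_infty s K < +oo)%E.
Proof.
apply: (@le_lt_trans _ _ ((4 / c) `^ s)%:E); last exact: ltry.
apply: (@M_radii_cover _ _ s (fun r => is_true (0 < r)) _ unit
  (fun=> K) (fun=> R0) 1) => //.
- by move=> x Kx; exists tt.
- by move=> _; apply: ediam_le => //; exact: ltW.
case=> [|[] [|[] l]] //= ul; first by rewrite big_nil lee_fin powR_ge0.
by rewrite big_seq1; exact: Phi_lty.
Qed.

(** The sums are bounded by 1 and the empty family is admissible, so a supremum exists. The cap
    [tau] on the ratios later brings transported labels below a given scale. *)
Lemma near_maximal_family (tau eps : R) : 0 < eps ->
  exists (J : finType) (q : J -> R) f,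
    [/\ separated_family q f, forall j, q j <= tau &
      forall (J' : finType) (q' : J' -> R) f', separated_family q' f' ->
        (forall j, q' j <= tau) -> \sum_j q' j `^ s <= \sum_j q j `^ s + eps].
Proof.
move=> eps0.
pose S := [set v : R | exists (J : finType) (q : J -> R) f,
  [/\ separated_family q f, forall j, q j <= tau & v = \sum_j q j `^ s]].
have S1 : ubound S 1.
  by move=> _ [J [q [f [fam _ ->]]]]; exact: separated_family_le1 fam.
have S0 : S 0.
  exists void, (fun t : void => match t with end),
    (fun t : void => match t with end); split.
  - by split; [case|case|case|exists 1 => //; case].
  - by case.
  - by rewrite big1 //; case.
have hS : has_sup S by split; [exists 0|exists 1].
have [_ [J [q [f [fam qtau ->]]]] lt] := sup_adherent eps0 hS.
exists J, q, f; split=> // J' q' f' fam' q'tau.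
rewrite -lerBlDr; apply: le_trans (ltW lt); rewrite lerD2r.
by apply: ub_le_sup; [exists 1|exists J', q', f'].
Qed.

(** Compactness is applied to the sets of [y] with [f y] at distance at least 2 / (j + 1) from [x];
    as [f] contracts, thickening by 1 / (j + 1) uses up at most half of that distance. *)
Lemma image_dist_pos (q : R) f x : 0 < q < 1 -> is_similarity q f ->
  (forall y, K y -> x <> f y) ->
  exists2 rho, 0 < rho & forall y, K y -> rho <= edist x (f y).
Proof.
move=> /andP[q0 q1] fsim xf.
pose e (j : nat) : R := j.+1%:R^-1.
have e0 j : 0 < e j by rewrite invr_gt0 ltr0n.
pose U j := [set y | K y /\ 2 * e j <= edist x (f y)].
have KU : K `<=` \bigcup_j U j.
  move=> y Ky; have D0 : 0 < edist x (f y).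
    rewrite lt_neqAle edist_ge0 andbT; apply/eqP => D0; apply: (xf y Ky).
    by apply: edist_le0 => r r0; rewrite -D0 ltW.
  have D2 : 0 <= 2 / edist x (f y) by rewrite divr_ge0 // ltW.
  exists (Num.bound (2 / edist x (f y))) => //; split=> //.
  have := archi_boundP D2; move: (Num.bound _) => n.
  rewrite ltr_pdivrMr // => h; rewrite /e ler_pdivrMr ?ltr0n // -[n.+1%:R]natr1.
  by rewrite mulrDr mulr1 mulrC; apply: ltW; apply: ltr_wpDr => //; exact: ltW.
have [n nP] := K_compact e0 KU.
exists (e n) => // y Ky; have [j [jn [y' [Ky' y'x] yy']]] := nP y Ky.
have en : e n <= e j by rewrite lef_pV2 ?posrE ?ltr0n // ler_nat ltnW.
have := edist_triangle (f y) x (f y'); rewrite fsim => h.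
have := edist_ge0 y y'; nra.
Qed.

(* The part of [K] missed by a nearly maximal family is cut into Whitney cells:
   generation [n] lies at distance about [4 * lam n] from the images and is
   subdivided by a grid. Cells of equal colour are far apart, so near-optimal
   packings of them extend the family. *)
Lemma remainder_le (J : finType) (q : J -> R) f (tau eps delta : R) :
  separated_family q f -> 0 < tau -> 0 < delta -> 0 < eps ->
  (forall j, q j <= tau) ->
  (forall (J' : finType) (q' : J' -> R) f', separated_family q' f' ->
        (forall j, q' j <= tau) -> \sum_j q' j `^ s <= \sum_j q j `^ s + eps) ->
  (M_delta s delta (K `&` [set x | forall j y, K y -> x <> f j y]) <=
    ((4 / c) `^ s * eps *+ #|{: bool * {ffun 'I_d -> 'I_(2 * d.+1).+1}}|)%:E)%E.
Proof.
move=> fam tau0 delta0 eps0 qtau qmax.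
have [q01 fsim fK [eta eta0 fsep]] := fam.
(* The three bounds make the labels admissible, allow zooming, and keep the new ratios below
   [tau]. *)
pose lam0 := Order.min delta (Order.min R0 tau).
have lam00 : 0 < lam0 by rewrite !lt_min delta0 R0_gt0 tau0.
pose lam n := lam0 / 2 ^+ n.
have lam_gt0 n : 0 < lam n by rewrite divr_gt0 // exprn_gt0.
have lamS n : lam n = 2 * lam n.+1.
  by rewrite /lam exprS; field; rewrite gt_eqF // exprn_gt0.
have lam_le n m : (n <= m)%N -> lam m <= lam n.
  move=> nm; rewrite ler_pM2l // lef_pV2 ?posrE ?exprn_gt0 //.
  by rewrite ler_weXn2l // ler1n.
have lam_lam0 n : lam n <= lam0.
  by rewrite -[leRHS]divr1 -[in leRHS](expr0 2); exact: lam_le.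
pose far n x := forall j y, K y -> 4 * lam n <= edist x (f j y).
pose h n := lam n / d.+1%:R.
have h0 n : 0 < h n by rewrite divr_gt0.
(* The generation of a point is the first [n] at which it is far from all images; the mesh [h n]
   gives its cell diameter at most [lam n]. *)
pose cell (t : nat * {ffun 'I_d -> int}) : set 'rV[R]_d :=
  [set x | [/\ K x, far t.1 x, forall n, t.1 = n.+1 -> ~ far n x &
              grid_index (h t.1) x = t.2]].
(* Residues modulo 2d + 3 put distinct cells of one generation and colour at distance at least twice
   [lam n]. Equal parity makes different generations differ by at least two. *)
pose colour (t : nat * {ffun 'I_d -> int}) := (odd t.1, grid_colour (2 * d.+1) t.2).
have sep t t' x y : colour t = colour t' -> t <> t' -> cell t x -> cell t' y ->
    lam t.1 + lam t'.1 <= edist x y.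
  wlog tt' : t t' x y / (t.1 <= t'.1)%N => [wl|].
    have [|/ltnW] := leqP t.1 t'.1; first exact: wl.
    move=> t't ct nt xt yt; rewrite addrC edistC.
    by apply: wl => //; exact: nesym.
  case: t t' tt' => n z [n' z'] /= nn' [on cz] nt [/= Kx fx nx ix] [/= Ky fy ny iy].
  move: nn'; rewrite leq_eqVlt => /predU1P[nn'|nn'].
    subst n'; have := @grid_colour_edist _ _ (h n) (2 * d.+1) x y (h0 n).
    rewrite ix iy natrM -mulrA (mulrC d.+1%:R) divfK ?pnatr_eq0 // => /(_ cz) hh.
    rewrite -[X in X + _]mul1r -[X in _ + X]mul1r -mulrDl; apply: hh => zz.
    by apply: nt; rewrite zz.
  have nn2 : (n.+1 < n')%N.
    rewrite ltn_neqAle nn' andbT; apply/eqP => nn2; move: on.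
    by rewrite -nn2 /=; case: odd.
  (* The point [y] is not far at the generation preceding its own, hence close to some image from
     which [x] keeps a larger distance. *)
  case: n' nn' nn2 {iy} on nt fy ny => // n' _ nn2 _ _ fy ny.
  have [j /existsNP[u /not_implyP[Ku /negP]]] : exists j, ~ forall u, K u ->
    4 * lam n' <= edist y (f j u) by exact/existsNP/(ny n').
  rewrite -ltNge => yu; have xu := fx j u Ku.
  have := edist_triangle y x (f j u).
  have nn3 : (n.+1 <= n')%N by [].
  have := lam_le _ _ nn3; have := lam_le _ _ (leqW (ltnW nn3)); have := lamS n.
  lra.
apply: (@M_radii_cover _ _ s (fun r => is_true (0 < r <= delta)) _ _
  cell (fun t => lam t.1) delta).
- by move=> r /andP[].
- by rewrite delta0 lexx.
- move=> x [Kx xf].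
  have /choice[rho rhoP] j : exists rho, 0 < rho /\ forall y, K y -> rho <= edist x (f j y).
    by have [r r0 rP] := image_dist_pos (q01 j) (fsim j) (xf j); exists r.
  pose e := \big[Order.min/1]_j rho j.
  have e0 : 0 < e by apply/bigmin_gtP; split=> // j _; have [] := rhoP j.
  have : exists n, `[< far n x >].
    have l0 : 0 <= 4 * lam0 / e by rewrite divr_ge0 ?ltW // mulr_gt0.
    exists (Num.bound (4 * lam0 / e)); apply/asboolP => j y Ky.
    have [_ /(_ y Ky)] := rhoP j; apply: le_trans.
    apply: (@le_trans _ _ e); last exact: bigmin_le.
    have := archi_boundP l0; move: (Num.bound _) => n.
    rewrite mulrA ler_pdivrMr ?exprn_gt0 // ltr_pdivrMr // => /ltW/le_trans; apply.
    by rewrite mulrC ler_wpM2l ?(ltW e0) // -natrX ler_nat ltnW // ltn_expl.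
  move=> nf; case: (ex_minnP nf) => n /asboolP fn nmin.
  exists (n, grid_index (h n) x) => //; split=> //= m nm.
  move=> /asboolP/nmin; by rewrite nm ltnn.
- move=> t; apply: ediam_le; first exact: ltW.
  move=> x y [_ _ _ ix] [_ _ _ iy].
  apply: le_trans (grid_index_edist (h0 t.1) (etrans ix (esym iy))) _.
  rewrite /h mulrCA ger_pMr // ler_pdivrMr ?mul1r ?ler_nat // ltr0n.
- by move=> t; rewrite lam_gt0 (le_trans (lam_lam0 _)) // ge_min lexx.
move=> l ul.
(* Each colour class costs at most (4/c)^s times eps: a packing drawn from it extends the family,
   and near-maximality bounds the added ratios. *)
rewrite (partition_big colour xpredT) //=.
apply: (@le_trans _ _ (\sum_(k : bool * {ffun 'I_d -> 'I_(2 * d.+1).+1})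
  ((4 / c) `^ s * eps)%:E)%E); last by rewrite sumEFin sumr_const.
apply: lee_sum => k _; rewrite -big_filter.
apply: sum_Phi_le => //; first exact: filter_uniq.
  move=> t t' x y; rewrite !mem_filter => /andP[/eqP tk _] /andP[/eqP t'k _].
  by apply: sep; rewrite tk t'k.
move=> P x r xr xp.
have Kx i : K (x i) by have [t _ [[]]] := xr i.
have r_lam0 i : 0 < r i <= lam0.
  have [t _ [_ /andP[r0 rt]]] := xr i.
  by rewrite r0 (le_trans rt).
have lam0R : lam0 <= R0 by rewrite !ge_min lexx orbT.
have lam0tau : lam0 <= tau by rewrite !ge_min lexx !orbT.
have rR0 i : 0 < r i <= R0.
  by have /andP[r0 rl] := r_lam0 i; rewrite r0 (le_trans rl).
have ravoid i j y : K y -> r i <= edist (x i) (f j y).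
  move=> Ky; have [t _ [[_ ft _ _] /andP[r0 rt]]] := xr i.
  apply: le_trans (ft j y Ky); apply: le_trans rt _.
  by have := lam_gt0 t.1; lra.
have [q' [f' [fam' q'r]]] := separated_family_extend fam Kx rR0 xp ravoid.
move=> /le_trans; apply; rewrite ler_wpM2l ?powR_ge0 //.
have := qmax _ _ _ fam'; rewrite big_sumType /= lerD2l; apply.
case=> [j|i]; first exact: qtau.
have /andP[_ rl] := r_lam0 i.
exact: le_trans (q'r i) (le_trans rl lam0tau).
Qed.

(** [M_radii_expanding] applied to an inverse of [f], selected pointwise on the image. *)
Lemma M_delta_image_le (q : R) f (r delta : R) : 0 < q -> is_similarity q f ->
  q * r <= delta ->
  (M_delta s delta (f @` K) <= (q `^ s)%:E * M_delta s r K)%E.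
Proof.
move=> q0 fsim qr.
have /choice[h hP] x : exists y, (f @` K) x -> K y /\ f y = x.
  have [[y Ky <-]|nx] := pselect ((f @` K) x); first by exists y.
  by exists x.
have qs0 : 0 < q `^ s by exact: powR_gt0.
have qV0 : 0 < q^-1 by rewrite invr_gt0.
rewrite -lee_pdivrMl // -(powRVl s (ltW q0)).
apply: (M_radii_expanding (P := fun t => is_true (0 < t <= delta))
  (Q := fun t => is_true (0 < t <= r)) (h := h) s_gt0 qV0).
- by move=> t /andP[].
- move=> t /andP[t0 tr]; rewrite invrK mulr_gt0 //=.
  by apply: le_trans qr; rewrite mulrC ler_pM2l.
- by move=> x /hP[].
- move=> x y /hP[_ hx] /hP[_ hy].
  by rewrite -[in RHS]hx -[in RHS]hy fsim mulKf // gt_eqF.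
Qed.

Lemma M_delta_le_M_infty delta : 0 < delta ->
  (M_delta s delta K <= M_infty s K)%E.
Proof.
move=> delta0; apply/ereal_infP => _ [E [rho [KE Erho rho0 ->]]].
have [->|] := eqVneq (\sum_(0 <= j <oo) Phi s (E j) (rho j))%E +oo%E.
  by rewrite leey.
rewrite -ltey => lty; have [r r0 Mr] := M_delta_le_cover s_gt0 KE Erho rho0 lty.
set theta := (\sum_(0 <= j <oo) Phi s (E j) (rho j))%E in lty Mr *.
have theta_fin : theta \is a fin_num.
  rewrite ge0_fin_numE //; apply: nneseries_ge0 => j _ _; exact: Phi_ge0.
rewrite -(fineK theta_fin) in Mr *.
have theta0 : 0 <= fine theta.
  rewrite fine_ge0 //; apply: nneseries_ge0 => j _ _; exact: Phi_ge0.
set N := #|{: bool * {ffun 'I_d -> 'I_(2 * d.+1).+1}}|.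
(* By [remainder_le], a defect of [e / C] in the family makes the rest of [K] cost at most [e]. *)
pose C := (4 / c) `^ s *+ N.+1.
have C0 : 0 < C by rewrite pmulrn_lgt0 // powR_gt0 // divr_gt0.
apply/lee_addgt0Pr => e e0.
have eC0 : 0 < e / C by rewrite divr_gt0.
have tau0 : 0 < delta / r by rewrite divr_gt0.
(* Ratios at most delta / r turn labels bounded by [r] into labels bounded by [delta]. *)
have [J [q [f [fam qtau qmax]]]] := near_maximal_family (delta / r) eC0.
have rem := remainder_le fam tau0 delta0 eC0 qtau qmax.
have [q01 fsim fK _] := fam.
have q0 j : 0 < q j by have /andP[] := q01 j.
set rest := K `&` _ in rem.
have Ksplit : K `<=` \bigcup_j (f j @` K) `|` rest.
  move=> x Kx; have [[j [y Ky xy]]|nx] := pselect (exists j, exists2 y, K y & x = f j y).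
    by left; exists j => //; exists y.
  right; split=> // j y Ky xy; apply: nx; exists j; by exists y.
have P0 t : is_true (0 < t <= delta) -> 0 < t by case/andP.
have Pd : is_true (0 < delta <= delta) by rewrite delta0 lexx.
apply: le_trans (M_radii_subset s P0 Ksplit) _.
apply: le_trans (M_radii_bigcup s (fun j => f j @` K) rest P0 Pd) _.
apply: leeD; last first.
  apply: le_trans rem _; rewrite lee_fin -mulrnAl mulrA ler_pdivrMr // mulrC.
  by apply: ler_wpM2l; [exact: ltW|apply: ler_wpMn2l; rewrite ?powR_ge0].
apply: (@le_trans _ _ (\sum_j (q j `^ s * fine theta)%:E)%E).
  apply: lee_sum => j _; rewrite EFinM.
  apply: le_trans (M_delta_image_le (r := r) (q0 j) (fsim j) _) _.
    by rewrite -ler_pdivlMr.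
  by rewrite lee_pmul2l // ?lte_fin ?powR_gt0.
rewrite sumEFin lee_fin -mulr_suml ler_piMl //.
exact: separated_family_le1 fam.
Qed.

Lemma zoom_M_stable : M_stable s K.
Proof. by split; [exact: M_delta_le_M_infty|exact: M_infty_lty]. Qed.

End Zoom.

(** * Hausdorff and packing dimension *)

Section Dimension.
Variables (R : realType) (d : nat).
Implicit Types (E F : set 'rV[R]_d) (t delta : R).
Local Open Scope ereal_scope.

Lemma nneseries_pair_le (c : nat * nat -> \bar R) : (forall k, 0 <= c k) ->
  \sum_(0 <= n <oo) oapp c 0 (pickle_inv n) <=
  \sum_(0 <= j <oo) \sum_(0 <= i <oo) c (j, i).
Proof.
move=> c0; apply: nneseries_pickle_le => // l ul.
rewrite nneseries_esumT; last by move=> j; apply: nneseries_ge0.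
under eq_esum do rewrite nneseries_esumT //.
rewrite esum_esum //; apply: esum_ge; exists [set` l].
  by split; [exact: finite_seq|move=> x _; split].
rewrite -fsbig_seq //=; rewrite le_eqVlt; apply/orP; left; apply/eqP.
by apply: eq_bigr => -[].
Qed.

Lemma nneseries_finite_le (u : nat -> \bar R) (N : nat) (b : R) :
  (forall i, 0 <= u i) -> (0 <= b)%R -> (forall i, (i < N)%N -> u i <= b%:E) ->
  (forall i, (N <= i)%N -> u i = 0) ->
  \sum_(0 <= i <oo) u i <= (b *+ N)%:E.
Proof.
move=> u0 b0 ub uN; apply: nneseries_le => // n.
suff : \sum_(0 <= i < n) u i <= (b *+ minn n N)%:E.
  move=> /le_trans; apply; rewrite lee_fin; apply: ler_wpMn2l => //.
  exact: geq_minr.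
elim: n => [|n IH]; first by rewrite big_geq // min0n.
rewrite big_nat_recr //=; have [nN|Nn] := ltnP n N.
  rewrite (minn_idPl nN) mulrSr EFinD; apply: leeD; last exact: ub.
  by rewrite (minn_idPl (ltnW nN)) in IH.
rewrite uN // adde0; apply: le_trans IH _.
by rewrite (minn_idPr Nn) (minn_idPr (leqW Nn)).
Qed.

Lemma hausdorff_cost_ge0 t E : 0 <= hausdorff_cost t E.
Proof. by rewrite /hausdorff_cost; case: eqP => // _; exact: poweR_ge0. Qed.

Lemma hausdorff_cost_le t E (b : R) : (0 <= t)%R -> (0 <= b)%R ->
  ediam E <= b%:E -> hausdorff_cost t E <= (b `^ t)%:E.
Proof.
move=> t0 b0 Eb; rewrite /hausdorff_cost.
case: eqP => _; first by rewrite lee_fin powR_ge0.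
rewrite -poweR_EFin; apply: gt0_ler_poweR => //.
  by rewrite in_itv /= leey ediam_ge0.
by rewrite in_itv /= leey lee_fin b0.
Qed.

Lemma hausdorff_content_ge0 t delta F : 0 <= hausdorff_content t delta F.
Proof.
apply/ereal_infP => _ [E [_ _ ->]].
by apply: nneseries_ge0 => n _ _; exact: hausdorff_cost_ge0.
Qed.

Lemma hausdorff_measure_ge0 t F : 0 <= hausdorff_measure t F.
Proof.
apply: le_trans (hausdorff_content_ge0 t 1 F) _.
by apply: ereal_sup_ubound; exists 1%R => //=.
Qed.

Lemma hausdorff_measure_subset t E F : E `<=` F ->
  hausdorff_measure t E <= hausdorff_measure t F.
Proof.
move=> EF; apply/ereal_supP => _ [e e0 <-].
apply: (@le_trans _ _ (hausdorff_content t e F)); last first.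
  by apply: ereal_sup_ubound; exists e.
apply: ereal_inf_le_tmp => _ [G [FG Ge ->]].
by exists G; split => //; exact: subset_trans FG.
Qed.

Lemma hausdorff_measure_set0 t : hausdorff_measure t (set0 : set 'rV[R]_d) = 0.
Proof.
apply/eqP; rewrite eq_le hausdorff_measure_ge0 andbT.
apply/ereal_supP => _ [e e0 <-]; apply: ereal_inf_lbound.
exists (fun=> set0); split => //.
- by move=> j; rewrite ediam_set0 lee_fin ltW.
- by rewrite eseries0 // => i _ _; rewrite /hausdorff_cost eqxx.
Qed.

Lemma packing_content_ge0 t delta F : 0 <= packing_content t delta F.
Proof.
apply: ereal_sup_ubound; exists 0%N, (fun=> 0%R), (fun=> 0%R).
by split=> [[]|[]|[]|] //; rewrite big_ord0.
Qed.

Lemma packing_premeasure_ge0 t F : 0 <= packing_premeasure t F.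
Proof. by apply/ereal_infP => _ [e _ <-]; exact: packing_content_ge0. Qed.

Lemma packing_premeasure_set0 t : packing_premeasure t (set0 : set 'rV[R]_d) = 0.
Proof.
apply/eqP; rewrite eq_le packing_premeasure_ge0 andbT.
apply: (@le_trans _ _ (packing_content t 1 (set0 : set 'rV[R]_d))).
  by apply: ereal_inf_lbound; exists 1%R => //=.
apply/ereal_supP => _ [N [x [r [Ex _ _ ->]]]].
by rewrite big1 // => i; case: (Ex i).
Qed.

Lemma packing_measure_ge0 t F : 0 <= packing_measure t F.
Proof.
apply/ereal_infP => _ [E [_ ->]].
by apply: nneseries_ge0 => n _ _; exact: packing_premeasure_ge0.
Qed.

Lemma packing_measure_bigcup0 t (I : countType) (E : I -> set 'rV[R]_d) F :
  F `<=` \bigcup_i E i -> (forall i, packing_premeasure t (E i) = 0) ->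
  packing_measure t F = 0.
Proof.
move=> FE E0; apply/eqP; rewrite eq_le packing_measure_ge0 andbT.
apply: ereal_inf_lbound; exists (fun n => oapp E set0 (pickle_inv n)); split.
  by move=> x /FE[i _ Eix]; exists (pickle i) => //; rewrite pickleK_inv.
rewrite eseries0 // => i _ _.
by case: pickle_inv => [j|] /=; rewrite ?packing_premeasure_set0.
Qed.

(** The bound on packing sums limits the number of disjoint [r]-balls, so a largest packing exists.
    A point farther than 2 r from all its centres could be added. *)
Lemma maximal_packing t delta (r B : R) E : (0 <= t)%R -> (0 < r <= delta)%R ->
  packing_content t delta E <= B%:E ->
  exists (N : nat) (x : nat -> 'rV[R]_d),
    [/\ (((2 * r) `^ t) *+ N <= B)%R,
        forall i, (i < N)%N -> E (x i) &
        forall y, E y -> exists2 i, (i < N)%N & (edist (x i) y <= 2 * r)%R].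
Proof.
move=> t0 /andP[r0 rd] EB.
pose Q n := `[< exists x : 'I_n -> 'rV[R]_d, (forall i, E (x i)) /\
  forall i j, i != j -> ecball (x i) r `&` ecball (x j) r = set0 >].
have r2 : (0 < (2 * r) `^ t)%R by rewrite powR_gt0 // mulr_gt0.
have Qle n : Q n -> (((2 * r) `^ t) *+ n <= B)%R.
  move=> /asboolP[x [Ex xr]]; rewrite -lee_fin; apply: le_trans EB.
  apply: ereal_sup_ubound; exists n, x, (fun=> r); split => //.
    by move=> _; rewrite r0.
  by rewrite sumr_const card_ord.
have B0 : (0 <= B)%R.
  by rewrite -lee_fin; apply: le_trans EB; exact: packing_content_ge0.
have Q0 : exists n, Q n.
  by exists 0%N; apply/asboolP; exists (fun=> 0%R); split=> -[].
have Qbnd n : Q n -> (n <= Num.bound (B / (2 * r) `^ t))%N.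
  move=> /Qle; rewrite -mulr_natr -ler_pdivlMl // mulrC => h.
  rewrite -(ler_nat R) ltW //; apply: le_lt_trans h _.
  by apply: archi_boundP; rewrite divr_ge0 // ltW.
case: (ex_maxnP Q0 Qbnd) => N QN Nmax.
have := QN => /asboolP[x [Ex xr]].
exists N, (fun i => oapp x 0%R (insub i)); split; first exact: Qle.
  by move=> i iN; rewrite insubT /=.
move=> y Ey; apply: contrapT => far.
have yx i : (2 * r < edist (x i) y)%R.
  rewrite ltNge; apply/negP => le; apply: far; exists (nat_of_ord i); first exact: ltn_ord.
  by have -> : insub (nat_of_ord i) = Some i :> option 'I_N by exact: valK.
have dis i : ecball (x i) r `&` ecball y r = set0.
  rewrite -subset0 => z [/= xz yz]; have := yx i.
  have := edist_triangle z (x i) y; rewrite (edistC z y).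
  rewrite /ecball /= in xz yz; lra.
have : Q N.+1.
  apply/asboolP; exists (fun i => if unlift ord_max i is Some j then x j else y).
  split=> [i|i j]; first by case: unlift.
  case: (unliftP ord_max i) => [i' ->|->]; case: (unliftP ord_max j) => [j' ->|->].
  - by rewrite (inj_eq lift_inj); exact: xr.
  - by [].
  - by move=> _; rewrite setIC.
  - by rewrite eqxx.
by move/Nmax; rewrite ltnn.
Qed.

(* Doubling the balls of a maximal packing gives a cover. *)
Lemma hausdorff_measure_packing0 t F : (0 <= t)%R ->
  packing_measure t F = 0 -> hausdorff_measure t F = 0.
Proof.
move=> t0 P0; apply/eqP; rewrite eq_le hausdorff_measure_ge0 andbT.
apply/ereal_supP => _ [delta /= delta0 <-].
apply/lee_addgt0Pr => e e0; rewrite add0e.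
have t2 : (0 < 2 `^ t :> R)%R by rewrite powR_gt0.
(* The factor 2^t pays for doubling the radii; one half is spent on the packing measure, the other
   on the errors [w j]. *)
pose kap : R := (e / 2 `^ t / 2)%R.
have kap0 : (0 < kap)%R by rewrite !divr_gt0.
have : packing_measure t F < kap%:E by rewrite P0 lte_fin.
move=> /ereal_inf_lt[_ [E [FE ->]] Ekap].
pose p j := fine (packing_premeasure t (E j)).
have pE j : packing_premeasure t (E j) = (p j)%:E.
  rewrite fineK // ge0_fin_numE ?packing_premeasure_ge0 //.
  apply: le_lt_trans (lt_trans Ekap (ltry _)).
  apply: le_trans (nneseries_sum_ge (l := [:: j]) _ _); rewrite ?big_seq1 //.
  by move=> n; exact: packing_premeasure_ge0.
have p0 j : (0 <= p j)%R by rewrite -lee_fin -pE packing_premeasure_ge0.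
pose w j : R := (kap / (2 ^ j.+1)%:R)%R.
have w0 j : (0 < w j)%R by rewrite divr_gt0 // ltr0n expn_gt0.
have /choice[g gP] j : exists g : R * nat * (nat -> 'rV[R]_d),
  [/\ (0 < g.1.1)%R, (4 * g.1.1 <= delta)%R,
    (((2 * g.1.1) `^ t) *+ g.1.2 <= p j + w j)%R &
    forall y, E j y -> exists2 i, (i < g.1.2)%N & (edist (g.2 i) y <= 2 * g.1.1)%R].
  have : packing_premeasure t (E j) < (p j + w j)%:E.
    by rewrite pE lte_fin ltrDl.
  move=> /ereal_inf_lt[_ [dj /= dj0 <-]] /ltW cj.
  (* The covering sets have diameter at most 4 r, hence at most [delta]. *)
  pose r := Order.min dj (delta / 4)%R.
  have r0 : (0 < r)%R by rewrite lt_min dj0 divr_gt0.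
  have rd : (0 < r <= dj)%R by rewrite r0 ge_min lexx.
  have [N [x [h1 _ h2]]] := maximal_packing t0 rd cj.
  exists (r, N, x); split => //=.
  by rewrite mulrC -ler_pdivlMr // ge_min lexx orbT.
pose r j := (g j).1.1; pose N j := (g j).1.2; pose x j := (g j).2.
pose U (k : nat * nat) := if (k.2 < N k.1)%N
  then E k.1 `&` ecball (x k.1 k.2) (2 * r k.1) else set0.
have r0 j : (0 < r j)%R by have [] := gP j.
have Ud k : ediam (U k) <= (4 * r k.1)%:E.
  rewrite /U; case: ifP => _; last by rewrite ediam_set0 lee_fin mulr_ge0 // ltW.
  apply: ediam_le => [|y z [_ yx] [_ zx]]; first by rewrite mulr_ge0 // ltW.
  rewrite /ecball /= in yx zx.
  have := edist_triangle (x k.1 k.2) y z; rewrite (edistC y (x k.1 k.2)).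
  lra.
apply: (@le_trans _ _ (\sum_(0 <= n <oo)
    oapp (fun k => hausdorff_cost t (U k)) 0 (pickle_inv n))).
  apply: ereal_inf_lbound; exists (fun n => oapp U set0 (pickle_inv n)); split.
  - move=> y /FE[j _ Ejy]; have [_ _ _ /(_ y Ejy)[i iN iy]] := gP j.
    exists (pickle (j, i)) => //; rewrite pickleK_inv /= /U /=.
    by rewrite ifT.
  - move=> n; case: pickle_inv => [k|] /=; last by rewrite ediam_set0 lee_fin ltW.
    by apply: le_trans (Ud k) _; rewrite lee_fin; have [] := gP k.1.
  - congr (limn _); apply/funext => n; apply: eq_bigr => i _.
    by case: pickle_inv => //=; rewrite /hausdorff_cost eqxx.
apply: le_trans (nneseries_pair_le _) _; first by move=> k; exact: hausdorff_cost_ge0.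
apply: (@le_trans _ _ (\sum_(0 <= j <oo)
  (2 `^ t)%:E * (packing_premeasure t (E j) + (w j)%:E))).
  apply: lee_nneseries => [j _ _|j _].
    by apply: nneseries_ge0 => n _ _; exact: hausdorff_cost_ge0.
  apply: le_trans (nneseries_finite_le (N := N j) (b := (4 * r j) `^ t) _ _ _ _) _.
  - by move=> i; exact: hausdorff_cost_ge0.
  - exact: powR_ge0.
  - move=> i iN; apply: hausdorff_cost_le => //.
    by rewrite mulr_ge0 // ltW.
  - by move=> i Ni; rewrite /U /= ltnNge Ni /= /hausdorff_cost eqxx.
  rewrite pE -EFinD -EFinM lee_fin.
  have -> : (4 * r j = 2 * (2 * r j) :> R)%R by rewrite mulrA; congr (_ * _)%R; ring.
  rewrite powRM ?mulr_ge0 ?(ltW (r0 j)) // -mulrnAr ler_pM2l //.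
  by have [] := gP j.
rewrite nneseriesZl; last first.
  move=> j _; rewrite adde_ge0 ?packing_premeasure_ge0 // lee_fin ltW //; exact: w0.
rewrite -lee_pdivlMl // -EFinM.
apply: le_trans (epsilon_trick xpredT _ (ltW kap0)) _.
  by move=> j; exact: packing_premeasure_ge0.
have -> : ((2 `^ t)^-1 * e)%:E = kap%:E + kap%:E.
  by rewrite -EFinD /kap mulrC -splitr.
by rewrite leeD2r // ltW.
Qed.

(** For radii at most delta, (2r)^t is at most (2 delta)^(t - s) times (2r)^s, and the first factor
    tends to 0 with delta. *)
Lemma packing_premeasure_eq0 (s t b r0 : R) F : (s < t)%R -> (0 < b)%R -> (0 < r0)%R ->
  (forall N (x : 'I_N -> 'rV[R]_d) (r : 'I_N -> R), (forall i, F (x i)) ->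
    (forall i, 0 < r i <= r0)%R -> is_packing x r ->
    (\sum_i (2 * r i) `^ s <= b)%R) ->
  packing_premeasure t F = 0.
Proof.
move=> st b0 r00 Fb; apply/eqP; rewrite eq_le packing_premeasure_ge0 andbT.
apply/lee_addgt0Pr => e e0; rewrite add0e.
have ts : (0 < t - s)%R by rewrite subr_gt0.
have eb : (0 < e / b)%R by rewrite divr_gt0.
pose delta := Order.min r0 ((e / b) `^ (t - s)^-1 / 2)%R.
have delta0 : (0 < delta)%R by rewrite lt_min r00 divr_gt0 // powR_gt0.
have delta_e : ((2 * delta) `^ (t - s) <= e / b)%R.
  have -> : (e / b = ((e / b) `^ (t - s)^-1) `^ (t - s) :> R)%R.
    by rewrite -powRrM mulVf ?gt_eqF // powRr1 // ltW.
  apply: le_powR2l; [exact: ltW|by rewrite mulr_ge0 // ltW|].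
  by rewrite mulrC -ler_pdivlMr // ge_min lexx orbT.
apply: (@le_trans _ _ (packing_content t delta F)).
  by apply: ereal_inf_lbound; exists delta.
apply/ereal_supP => _ [N [x [r [Fx rd dis ->]]]]; rewrite lee_fin.
have r0' i : (0 < r i)%R by have /andP[] := rd i.
have -> : (e = e / b * b :> R)%R by rewrite divfK // gt_eqF.
apply: (@le_trans _ _ (\sum_(i < N) e / b * (2 * r i) `^ s)%R).
  apply: ler_sum => i _; have r2 : (0 < 2 * r i)%R by rewrite mulr_gt0.
  rewrite -[t in leLHS](subrK s) powRD; last by rewrite (gt_eqF r2) implybT.
  rewrite ler_wpM2r ?powR_ge0 //; apply: le_trans delta_e.
  apply: le_powR2l; [exact: ltW|exact: ltW|].
  by rewrite ler_pM2l //; have /andP[] := rd i.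
rewrite -mulr_sumr ler_pM2l //; apply: Fb Fx _ _.
  move=> i; have /andP[ri0 rid] := rd i; rewrite ri0 (le_trans rid) //.
  by rewrite ge_min lexx.
by move=> i j /eqP ij; apply: disjoint_ecball => //; exact: dis.
Qed.

End Dimension.

(** * Subshifts and coding *)

Lemma is_similarity_comp (R : realType) (d : nat) (q q' : R)
    (f g : 'rV[R]_d -> 'rV[R]_d) :
  is_similarity q f -> is_similarity q' g -> is_similarity (q * q') (f \o g).
Proof. by move=> fq gq x y; rewrite /= fq gq mulrA. Qed.

Lemma is_similarity_id (R : realType) (d : nat) :
  is_similarity 1 (@id 'rV[R]_d).
Proof. by move=> x y; rewrite mul1r. Qed.

Lemma exp_small (R : realType) (r b e : R) : 0 <= r < 1 -> 0 < e ->
  exists n, r ^+ n * b < e.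
Proof.
move=> /andP[r0 r1] e0.
have : (fun n => r ^+ n * b) @ \oo --> (0 : R).
  rewrite -[X in _ --> X](mul0r b); apply: cvgMl.
  by apply: cvg_expr; rewrite ger0_norm.
move/cvgrPdist_lt => /(_ _ e0)[N _ hN]; exists N.
have := hN N (leqnn _); rewrite sub0r normrN; apply: le_lt_trans.
exact: ler_norm.
Qed.

Section Coding.
Variables (R : realType) (d : nat) (I : finType).
Variables (S : I -> 'rV[R]_d -> 'rV[R]_d) (a : I -> R) (A : rel I).
Hypothesis a01 : forall i, 0 < a i < 1.
Hypothesis S_sim : forall i, is_similarity (a i) (S i).

Let amax := \big[Order.max/2^-1]_i a i.
Let amin := \big[Order.min/1]_i a i.

Lemma amax01 : 0 <= amax < 1.
Proof.
apply/andP; split; first by apply: le_trans (bigmax_ge_id _ _ _ _); rewrite invr_ge0.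
apply/bigmax_ltP; split=> [|i _]; first by rewrite invf_lt1 ?ltr1n // ltr0n.
by have /andP[] := a01 i.
Qed.

Lemma le_amax i : a i <= amax.
Proof. exact: le_bigmax. Qed.

Lemma amin_gt0 : 0 < amin.
Proof. by apply/bigmin_gtP; split=> // i _; have /andP[] := a01 i. Qed.

Lemma amin_le i : amin <= a i.
Proof. exact: bigmin_le. Qed.

Lemma amin_le1 : amin <= 1.
Proof. exact: bigmin_le_id. Qed.

Let shift (alpha : nat -> I) n := alpha n.+1.
Let scons i (alpha : nat -> I) n := if n is m.+1 then alpha m else i.

Lemma mkseqS (alpha : nat -> I) n :
  mkseq alpha n.+1 = alpha 0%N :: mkseq (shift alpha) n.
Proof. by rewrite /mkseq /= -[1%N]addn0 iotaDl -map_comp. Qed.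

(** With [b] bounding the displacements of 0 by the maps, the constant solves C = b + amax C, so the
    bound for length 0 is inherited under one more map. *)
Lemma partial_coding_bound : exists2 C, 0 <= C & forall alpha m n, (m <= n)%N ->
  edist (foldr S 0 (mkseq alpha m)) (foldr S 0 (mkseq alpha n)) <= amax ^+ m * C.
Proof.
have /andP[am0 am1] := amax01.
pose b := \big[Order.max/0]_i edist 0 (S i 0).
have b0 : 0 <= b by exact: bigmax_ge_id.
have am1' : 0 < 1 - amax by rewrite subr_gt0.
exists (b / (1 - amax)); first by rewrite divr_ge0 // ltW.
set C := b / _; have C0 : 0 <= C by rewrite divr_ge0 // ltW.
have CE : C = b + amax * C by rewrite /C; field; rewrite gt_eqF.
move=> alpha m; elim: m alpha => [|m IH] alpha n; last first.
  case: n => // n mn; rewrite !mkseqS /= S_sim exprS -mulrA.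
  apply: ler_pM; [by have /andP[/ltW] := a01 (alpha 0%N)|exact: edist_ge0|exact: le_amax|].
  exact: IH.
move=> _; rewrite expr0 mul1r /=.
elim: n alpha => [|n IH] alpha; first by rewrite edistxx.
rewrite mkseqS /= CE; apply: le_trans (edist_triangle (S (alpha 0%N) 0) _ _) _.
apply: lerD; first exact: le_bigmax.
rewrite S_sim; apply: ler_pM; [|exact: edist_ge0|exact: le_amax|exact: IH].
by have /andP[/ltW] := a01 (alpha 0%N).
Qed.

Lemma coding_bound : exists2 C, 0 <= C & forall alpha m,
  edist (foldr S 0 (mkseq alpha m)) (coding S alpha) <= amax ^+ m * C.
Proof.
have [C C0 CP] := partial_coding_bound; exists C => // alpha m.
apply: (@cvg_edist_lim _ _ (fun n => foldr S 0 (mkseq alpha n))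
  (fun n => amax ^+ n * C)) => [|k n kn]; last exact: CP.
rewrite -[X in _ --> X](mul0r C); apply: cvgMl; apply: cvg_expr.
by have /andP[am0 am1] := amax01; rewrite ger0_norm.
Qed.

(** Both points are within [amax ^+ m * C] of the partial composition of length m + 1. *)
Lemma codingS alpha : coding S alpha = S (alpha 0%N) (coding S (shift alpha)).
Proof.
have [C C0 CP] := coding_bound; have /andP[am0 am1] := amax01.
apply: edist_le0 => e e0; have [m me] := exp_small (2 * C) amax01 e0.
apply: le_trans (ltW me).
apply: le_trans (edist_triangle (foldr S 0 (mkseq alpha m.+1)) _ _) _.
have -> : amax ^+ m * (2 * C) = amax ^+ m * C + amax ^+ m * C by ring.
apply: lerD.
  rewrite edistC; apply: le_trans (CP _ _) _.
  by rewrite ler_wpM2r // exprS ler_piMl ?exprn_ge0 // ltW.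
rewrite mkseqS /= S_sim; apply: le_trans (CP (shift alpha) m).
by rewrite ler_piMl ?edist_ge0 //; have /andP[_ /ltW] := a01 (alpha 0%N).
Qed.

Lemma coding_edist_le : exists2 D, 1 <= D &
  forall alpha beta, edist (coding S alpha) (coding S beta) <= D.
Proof.
(* The summand 1 ensures [1 <= D], so that [q * D <= r] will imply [q <= r]. *)
have [C C0 CP] := coding_bound; exists (1 + (C + C)) => [|alpha beta].
  by rewrite lerDl addr_ge0.
apply: le_trans (edist_triangle 0 _ _) _; apply: ler_wpDl => //.
apply: lerD; last by have := CP beta 0%N; rewrite expr0 mul1r.
by rewrite edistC; have := CP alpha 0%N; rewrite expr0 mul1r.
Qed.

Lemma cylinder_cons i w alpha :
  cylinder (i :: w) alpha <-> alpha 0%N = i /\ cylinder w (shift alpha).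
Proof.
split=> [h|[h0 h] [|k] //= kw]; last exact: h.
by split=> [|k kw]; [exact: (h 0%N)|exact: (h k.+1)].
Qed.

Lemma subshift_shift alpha :
  subshift A alpha <-> A (alpha 0%N) (alpha 1%N) /\ subshift A (shift alpha).
Proof.
split=> [h|[h0 h] [|k] //]; last exact: h.
by split=> [|k]; [exact: h|exact: (h k.+1)].
Qed.

Lemma FAw_cons i w x : FAw S A (i :: w) x <->
  exists alpha, [/\ subshift A alpha, cylinder w alpha, A i (alpha 0%N) &
    x = S i (coding S alpha)].
Proof.
split=> [[alpha [sub /cylinder_cons[<- cyl]] <-]|[alpha [sub cyl Ai ->]]].
  by have /subshift_shift[Ai sub'] := sub; exists (shift alpha); split=> //;
    exact: codingS.
exists (scons i alpha); last exact: (codingS (scons i alpha)).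
split; last by apply/cylinder_cons.
by apply/subshift_shift.
Qed.

(** Peels off the first letter, which reduces any word to one letter up to similarity or to the
    empty set. *)
Lemma FAw_cons2 i j w : FAw S A (i :: j :: w) =
  if A i j then S i @` FAw S A (j :: w) else set0.
Proof.
apply/seteqP; split=> x.
  move=> /FAw_cons[alpha [sub cyl Ai ->]].
  have [a0 _] := (cylinder_cons j w alpha).1 cyl; subst j.
  by rewrite Ai; exists (coding S alpha) => //; exists alpha => //; split.
case: ifPn => // Aij [_ [alpha [sub cyl] <-] <-]; apply/FAw_cons.
exists alpha; split=> //.
by have [-> _] := (cylinder_cons j w alpha).1 cyl.
Qed.

Lemma FAw1 i : FAw S A [:: i] = S i @` GA S A i.
Proof.
apply/seteqP; split=> x.
  move=> /FAw_cons[alpha [sub _ Ai ->]]; exists (coding S alpha) => //.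
  exists (alpha 0%N) => //; exists alpha => //; split=> //.
  by apply/cylinder_cons.
case=> y [j Aij [alpha [sub /cylinder_cons[a0 _]] <-]] <-; apply/FAw_cons.
by exists alpha; split=> //; rewrite a0.
Qed.

Lemma FAw1_coding alpha : subshift A alpha -> FAw S A [:: alpha 0%N] (coding S alpha).
Proof. by move=> sub; exists alpha => //; split=> //; apply/cylinder_cons. Qed.

Lemma FA_bigcup : FA S A `<=` \bigcup_i FAw S A [:: i].
Proof. by move=> _ [alpha sub <-]; exists (alpha 0%N) => //; exact: FAw1_coding. Qed.

Lemma FAw_sub_FA w : FAw S A w `<=` FA S A.
Proof. by move=> _ [alpha [sub _] <-]; exists alpha. Qed.

Lemma FAw1_image i j y : A i j -> FAw S A [:: j] y -> FAw S A [:: i] (S i y).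
Proof.
move=> Aij [alpha [sub /cylinder_cons[a0 _]] <-]; apply/FAw_cons.
by exists alpha; split=> //; rewrite a0.
Qed.

Lemma FAw1_preimage i x : FAw S A [:: i] x ->
  exists j y, [/\ A i j, FAw S A [:: j] y & x = S i y].
Proof.
move=> /FAw_cons[alpha [sub _ Ai ->]]; exists (alpha 0%N), (coding S alpha).
by split=> //; exact: FAw1_coding.
Qed.

Lemma FAw1_edist_le : exists2 D, 1 <= D &
  forall i x y, FAw S A [:: i] x -> FAw S A [:: i] y -> edist x y <= D.
Proof.
have [D D1 DP] := coding_edist_le; exists D => // i _ _ [alpha _ <-] [beta _ <-].
exact: DP.
Qed.

(** A positive entry of a matrix power yields an admissible path from [i] to [j]; the maps along it
    are composed. *)
Lemma irreducible_similarity : irreducible_mx A -> forall i j,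
  exists q f, [/\ 0 < q < 1, is_similarity q f &
    forall x, FAw S A [:: j] x -> FAw S A [:: i] (f x)].
Proof.
move=> irr i j; have [n n1] := irr i j.
case: n n1 => // n _; elim: n i => [|n IH] i.
  rewrite expr1 mxE !enum_rankK => Aij; exists (a i), (S i); split=> // x.
  by apply: FAw1_image; move: Aij; case: (A i j).
rewrite exprS !mxE => /[!lt0n]; rewrite sum_nat_eq0 => /forallPn[k].
rewrite implyTb -lt0n muln_gt0 mxE enum_rankK => /andP[Aik].
rewrite -[k in X in (0 < X)%N]enum_valK => /IH[q [f [q01 fsim fP]]].
exists (a i * q), (S i \o f); split=> [||x Kx].
- have /andP[a0 a1] := a01 i; have /andP[q0 q1] := q01.
  by rewrite mulr_gt0 //= mulr_ilt1 // ltW.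
- exact: is_similarity_comp.
- by apply: FAw1_image (fP _ Kx); move: Aik; case: (A i _).
Qed.

(* Koenig's lemma: if no finite subfamily suffices, there is an infinite
   admissible word all of whose cylinders fail to be finitely covered; its
   coded point lies in some [U j], whose neighbourhood contains a cylinder. *)
Lemma FAw1_compact i : edist_compact (FAw S A [:: i]).
Proof.
move=> U e e0 KU; apply: contrapT => nfin.
pose fin (P : set 'rV[R]_d) := exists n, forall x, P x ->
  exists j, [/\ (j < n)%N & exists2 y, U j y & edist x y < e j].
pose image (p : ('rV[R]_d -> 'rV[R]_d) * I) := p.1 @` FAw S A [:: p.2].
(* A state records the composition so far and the current letter. Making the step conditional gives
   every state a successor, as dependent choice requires. *)
pose step p p' := ~ fin (image p) ->
  [/\ A p.2 p'.2, p'.1 = p.1 \o S p.2 & ~ fin (image p')].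
have stepP p : {p' | step p p'}.
  apply: cid; have [fp|nfp] := pselect (fin (image p)).
    by exists p => /(_ fp).
  apply: contrapT => nstep; apply: nfp.
  have /choice[N NP] j : exists n, A p.2 j -> forall x, image (p.1 \o S p.2, j) x ->
      exists k, [/\ (k < n)%N & exists2 y, U k y & edist x y < e k].
    have [Aj|nA] := pselect (A p.2 j); last by exists 0%N => /nA.
    have [[n nP]|nf] := pselect (fin (image (p.1 \o S p.2, j))); first by exists n.
    by case: nstep; exists (p.1 \o S p.2, j).
  exists (\max_j N j) => _ [x /FAw1_preimage[j [y [Aj Ky ->]]] <-].
  have [|k [kN kP]] := NP j Aj (p.1 (S p.2 y)); first by exists y.
  by exists k; split=> //; apply: leq_trans kN (leq_bigmax _).
have [g [g0 gS]] := dependent_choice stepP (id, i).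
have nfing n : ~ fin (image (g n)).
  elim: n => [|n IH]; last by have [] := gS n IH.
  rewrite g0; apply: contra_not nfin => -[n nP]; exists n => x Kx.
  by apply: nP; exists x.
pose alpha n := (g n).2.
have sub n : subshift A (fun k => alpha (n + k)%N).
  by move=> k; rewrite addnS; have [] := gS (n + k)%N (nfing _).
have xE n : coding S alpha = (g n).1 (coding S (fun k => alpha (n + k)%N)).
  elim: n => [|n IH]; first by rewrite g0.
  have [_ -> _] := gS n (nfing n); rewrite IH /= codingS /shift addn0.
  by congr ((g n).1 (S _ (coding S _))); apply/funext => k; rewrite addnS.
have gsim n : exists2 q, 0 <= q <= amax ^+ n & is_similarity q (g n).1.
  elim: n => [|n [q /andP[q0 qn] qsim]].
    by exists 1; rewrite ?g0 ?expr0 ?ler01 ?lexx //; exact: is_similarity_id.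
  have [_ -> _] := gS n (nfing n).
  exists (q * a (g n).2); last exact: is_similarity_comp.
  have /andP[a0 _] := a01 (g n).2.
  rewrite mulr_ge0 ?(ltW a0) //= exprSr; apply: ler_pM => //; first exact: ltW.
  exact: le_amax.
have Kx : FAw S A [:: i] (coding S alpha).
  by have := FAw1_coding (sub 0%N); rewrite /alpha g0.
have [j _ Ujx] := KU _ Kx.
have [D D1 DP] := FAw1_edist_le.
have [n nD] := exp_small D amax01 (e0 j).
(* The piece of generation [n] has diameter below [e j] and contains the coded point, so the single
   set [U j] serves all of it. *)
apply: (nfing n); exists j.+1 => _ [y Ky <-].
exists j; split=> //; exists (coding S alpha) => //.
have [q /andP[q0 qn] qsim] := gsim n.
rewrite (xE n) qsim; apply: le_lt_trans nD.
apply: ler_pM => //; first exact: edist_ge0.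
apply: (DP (g n).2) => //.
by have := FAw1_coding (sub n); rewrite addn0.
Qed.

End Coding.

(** * Small copies inside the one-letter pieces *)

Section SubshiftZoom.
Variables (R : realType) (d : nat) (I : finType).
Variables (S : I -> 'rV[R]_d -> 'rV[R]_d) (a : I -> R) (A : rel I).
Hypothesis a01 : forall i, 0 < a i < 1.
Hypothesis S_sim : forall i, is_similarity (a i) (S i).

(* Follow the coding of [x] until the cylinder containing [x] has size about
   [r]. *)
Lemma cylinder_of_size : exists c D, [/\ 0 < c, 1 <= D,
  forall i x y, FAw S A [:: i] x -> FAw S A [:: i] y -> edist x y <= D &
  forall i x r, FAw S A [:: i] x -> 0 < r <= D ->
    exists q f k, [/\ c * r <= q <= 1, q * D <= r, is_similarity q f,
      (f @` FAw S A [:: k]) x &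
      forall y, FAw S A [:: k] y -> FAw S A [:: i] (f y)]].
Proof.
have [D D1 DP] := FAw1_edist_le A a01 S_sim.
have D0 : 0 < D by exact: lt_le_trans D1.
have am0 := amin_gt0 a01; have am_le1 := amin_le1 a.
set m := \big[Order.min/1]_i a i in am0 am_le1.
exists (m / D), D; split => //; first by rewrite divr_gt0.
move=> i x r Kx /andP[r0 rD].
pose good := exists q f k, [/\ m / D * r <= q <= 1, q * D <= r, is_similarity q f,
      (f @` FAw S A [:: k]) x &
      forall y, FAw S A [:: k] y -> FAw S A [:: i] (f y)].
pose am := \big[Order.max/2^-1]_i a i.
(* Either a suitable cylinder has been found or the one reached at depth [n] is still too large; the
   latter fails for large [n]. *)
suff claim n : good \/ exists q f k, [/\ r < q * D, q <= am ^+ n /\ q <= 1,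
    is_similarity q f, (f @` FAw S A [:: k]) x &
    forall y, FAw S A [:: k] y -> FAw S A [:: i] (f y)].
  have [n nr] := exp_small D (amax01 a01) r0.
  have [gd|[q [f [k [rq [qn _] _ _ _]]]]] := claim n; first exact: gd.
  exfalso; move: nr; apply/negP; rewrite -leNgt; apply: le_trans (ltW rq) _.
  by rewrite ler_wpM2r // ltW.
elim: n => [|n [|[q [f [k [rq [qn q1] qsim [y Ky yx] fk]]]]]]; [|by left|].
  have [Dr|rD'] := leP D r.
    left; exists 1, id, i; split=> //; [|by rewrite mul1r|exact: is_similarity_id|].
      by rewrite lexx andbT mulrAC ler_pdivrMr //; apply: ler_pM => //; exact: ltW.
    by exists x.
  right; exists 1, id, i; split=> //; [by rewrite mul1r|exact: is_similarity_id|].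
  by exists x.
have [j [z [Akj Kz yz]]] := FAw1_preimage a01 S_sim Ky.
have /andP[ak0 ak1] := a01 k.
have q0 : 0 < q by rewrite -(pmulr_lgt0 _ D0) (lt_trans r0).
have fsim : is_similarity (q * a k) (f \o S k) by exact: is_similarity_comp.
have fx : ((f \o S k) @` FAw S A [:: j]) x by exists z => //=; rewrite -yz.
have fK u : FAw S A [:: j] u -> FAw S A [:: i] ((f \o S k) u).
  by move=> Ku; apply: fk; exact: (FAw1_image a01 S_sim Akj Ku).
have qa1 : q * a k <= 1 by rewrite mulr_ile1 // ltW.
(* The previous ratio satisfied q D > r, so the first admissible one is at least m r / D. *)
have [small|big] := leP (q * a k * D) r.
  left; exists (q * a k), (f \o S k), j; split=> //; rewrite qa1 andbT.
  have mk : m <= a k by exact: amin_le.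
  rewrite mulrAC ler_pdivrMr // (_ : q * a k * D = a k * (q * D)); last by ring.
  by apply: ler_pM => //; exact: ltW.
right; exists (q * a k), (f \o S k), j; split=> //; split=> //.
rewrite exprSr; apply: ler_pM => //; [exact: ltW|exact: ltW|exact: le_amax].
Qed.

(** The cylinder of size [r] at [x] is a copy of some one-letter piece, into which irreducibility
    maps the piece of [i] with ratio at least [c1]. *)
Lemma FAw1_zoom i : irreducible_mx A -> exists c D, [/\ 0 < c, 0 < D,
  forall x y, FAw S A [:: i] x -> FAw S A [:: i] y -> edist x y <= D &
  forall x r, FAw S A [:: i] x -> 0 < r <= D ->
    exists q f, [/\ c * r <= q <= r, q < 1, is_similarity q f &
      forall y, FAw S A [:: i] y ->
        FAw S A [:: i] (f y) /\ edist x (f y) <= r]].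
Proof.
move=> irr; have [c [D [c0 D1 DP cP]]] := cylinder_of_size.
have D0 : 0 < D by exact: lt_le_trans D1.
have /choice[g gP] k : exists g : R * ('rV[R]_d -> 'rV[R]_d),
    [/\ 0 < g.1 < 1, is_similarity g.1 g.2 &
      forall x, FAw S A [:: i] x -> FAw S A [:: k] (g.2 x)].
  by have [q [f h]] := irreducible_similarity a01 S_sim irr k i; exists (q, f).
pose c1 := \big[Order.min/1]_k (g k).1.
have c10 : 0 < c1 by apply/bigmin_gtP; split=> // k _; have [/andP[]] := gP k.
exists (c * c1), D; split=> //; [exact: mulr_gt0|exact: DP|].
move=> x r Kx rD; have [q [f [k [/andP[cq q1] qD qsim [z Kz zx] fk]]]] := cP i x r Kx rD.
have /andP[r0 _] := rD.
have [/andP[g0 g1] gsim gK] := gP k.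
have q0 : 0 < q by apply: lt_le_trans cq; exact: mulr_gt0.
exists (q * (g k).1), (f \o (g k).2); split.
- apply/andP; split.
    rewrite mulrAC; apply: ler_pM => //; [by rewrite mulr_ge0 // ltW|exact: ltW|].
    exact: bigmin_le.
  apply: le_trans qD; rewrite ler_pM2l //; apply: le_trans D1; exact: ltW.
- by apply: le_lt_trans g1; rewrite ler_piMl // ltW.
- exact: is_similarity_comp.
move=> y Ky; have Kgy := gK _ Ky; split; first exact: fk.
rewrite -zx /= qsim; apply: le_trans qD; rewrite ler_pM2l //.
exact: (DP k).
Qed.

End SubshiftZoom.

(** * Equality of dimensions and reduction to one-letter pieces *)

Theorem theorem1p3 (R : realType) (d : nat) (I : finType)
    (S : I -> 'rV[R]_d -> 'rV[R]_d) (a : I -> R) (A : rel I) (s : R)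
    (a01 : forall i, 0 < a i < 1)
    (S_sim : forall i, is_similarity (a i) (S i))
    (A_irr : irreducible_mx A)
    (s_dim : hausdorff_dim (FA S A) = s%:E)
    (s_gt0 : 0 < s) :
  packing_dim (FA S A) = s%:E /\
  (forall K : set 'rV[R]_d,
     (exists w : seq I, w <> [::] /\ K = FAw S A w) \/
     (exists i : I, K = GA S A i) ->
   forall delta : R, 0 < delta ->
     [/\ M_infty s K = M_delta s delta K,
         M_delta s delta K = M_measure s K &
         (M_measure s K < +oo)%E]).
Proof.
(* The empty set has dimension 0, whereas [s] is positive. *)
have FA_neq0 : FA S A !=set0.
  apply/set0P/eqP => FA0.
  have : (hausdorff_dim (FA S A) <= 0%:E)%E.
    apply: ereal_inf_lbound; exists 0 => //; split=> //=.
    by rewrite FA0 hausdorff_measure_set0.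
  by rewrite s_dim lee_fin leNgt s_gt0.
have K_neq0 i : FAw S A [:: i] !=set0.
  have [x /FA_bigcup[j _ Kjx]] := FA_neq0.
  have [q [f [_ _ fK]]] := irreducible_similarity a01 S_sim A_irr i j.
  by exists (f x); exact: fK.
have K_dim i e : 0 < e ->
    exists2 u, s <= u < s + e & hausdorff_measure u (FAw S A [:: i]) = 0%E.
  move=> e0; have : (hausdorff_dim (FA S A) < (s + e)%:E)%E.
    by rewrite s_dim lte_fin ltrDl.
  move=> /ereal_inf_lt[_ [u [u0 Hu] <-]]; rewrite lte_fin => use.
  exists u.
    rewrite use andbT -lee_fin -s_dim; apply: ereal_inf_lbound.
    by exists u.
  apply/eqP; rewrite eq_le hausdorff_measure_ge0 andbT -Hu.
  exact/hausdorff_measure_subset/FAw_sub_FA.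
have K_compact i : edist_compact (FAw S A [:: i]) by move=> ? ?; exact: (FAw1_compact a01 S_sim).
have K_stable i : M_stable s (FAw S A [:: i]).
  have [c [D [c0 D0 DP cP]]] := FAw1_zoom a01 S_sim i A_irr.
  exact: zoom_M_stable s_gt0 (K_neq0 i) (K_compact i) c0 D0 DP cP (K_dim i).
split.
  apply/eqP; rewrite eq_le; apply/andP; split.
    (* At exponent [s + e] each one-letter piece has zero packing premeasure, by the uniform bound
       on packing sums at [s]. *)
    apply/lee_addgt0Pr => e e0; apply: ereal_inf_lbound.
    exists (s + e); last by rewrite EFinD.
    split=> /=; first by rewrite addr_ge0 // ltW.
    apply: (@packing_measure_bigcup0 _ _ _ I (fun i => FAw S A [:: i])).
      exact: FA_bigcup.
    move=> i; have [c [D [c0 D0 DP cP]]] := FAw1_zoom a01 S_sim i A_irr.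
    apply: (@packing_premeasure_eq0 _ _ s _ ((4 / c) `^ s) D) => //.
    + by rewrite ltrDl.
    + by rewrite powR_gt0 // divr_gt0.
    + move=> N x r Kx rD xr.
      exact: (packing_sum_le s_gt0 (K_neq0 i) (K_compact i) c0 cP (K_dim i)).
  apply/ereal_infP => _ [t [t0 Pt] <-]; rewrite -s_dim.
  apply: ereal_inf_lbound; exists t => //; split=> //.
  exact: hausdorff_measure_packing0.
have sim_inv i x y : (a i)^-1 * edist (S i x) (S i y) = edist x y.
  by rewrite S_sim mulKf // gt_eqF //; have /andP[] := a01 i.
have a0 i : 0 < a i by have /andP[] := a01 i.
have inv i (E : set 'rV[R]_d) : exists h : 'rV[R]_d -> 'rV[R]_d,
    forall x, (S i @` E) x -> E (h x) /\ S i (h x) = x.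
  have /choice[h hP] x : exists y, (S i @` E) x -> E y /\ S i y = x.
    have [[y Ey yx]|nx] := pselect ((S i @` E) x); first by exists y.
    by exists x.
  by exists h.
have image_stable i E : M_stable s E -> M_stable s (S i @` E).
  have [h hP] := inv i E; apply: (M_stable_similar s_gt0 (h := S i) (h' := h) (a0 i)).
  - by move=> x Ex; exists x.
  - by move=> x y _ _; exact: S_sim.
  - by move=> x /hP[].
  - by move=> x y /hP[_ hx] /hP[_ hy]; rewrite -(sim_inv i) hx hy.
have preimage_stable i E : M_stable s (S i @` E) -> M_stable s E.
  have [h hP] := inv i E.
  have ai0 : 0 < (a i)^-1 by rewrite invr_gt0.
  apply: (M_stable_similar s_gt0 (h := h) (h' := S i) ai0).
  - by move=> x /hP[].
  - by move=> x y /hP[_ hx] /hP[_ hy]; rewrite -(sim_inv i) hx hy.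
  - by move=> x Ex; exists x.
  - by move=> x y _ _; rewrite invrK; exact: S_sim.
move=> K HK; apply: M_stableP.
case: HK => [[w [w0 ->]]|[i ->]]; last first.
  (* The image of G_i under [S i] is the one-letter piece of [i]. *)
  by apply: (preimage_stable i); rewrite -(FAw1 A a01 S_sim).
elim: w w0 => // i [|j w] IH _; first exact: K_stable.
rewrite (FAw_cons2 A a01 S_sim); case: ifP => _; last exact: M_stable_set0.
by apply: image_stable; exact: IH.
Qed.
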